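(* Let $F\in\mathrm{TAut}(L_2)$ be such that $F(x_1+x_2)=\log(e^{x_1}e^{x_2})$ and such that there exists $h(z)\in\mathbb{K}[[z]]$ with $j(F^{-1})=|h(x_1)+h(x_2)-h(x_1+x_2)|$. Then, for every $n\ge2$, $F^{(n)}\in\mathrm{TAut}(L_n)$ is a solution to the Kashiwara--Vergne problem of type $(0,n+1)$; that is, $$F^{(n)}(x_1+x_2+\cdots+x_n)=\log(e^{x_1}e^{x_2}\cdots e^{x_n})$$ and there exists $h(z)\in\mathbb{K}[[z]]$ such that $$j((F^{(n)})^{-1})=\Big|\sum_{i=1}^nh(x_i)-h\Big(\sum_{i=1}^nx_i\Big)\Big|.$$
   Context: $\mathbb{K}$ is a field of characteristic $0$; $A_n$ is the degree completion of the free associative $\mathbb{K}$-algebra on $x_1,\dots,x_n$, and $L_n\subset A_n$ is the completed free Lie algebra on $x_1,\dots,x_n$. $|A_n|=A_n/[A_n,A_n]$ ($[A_n,A_n]$ the closure of the span of commutators), with projection $a\mapsto|a|$. $\mathrm{tDer}(L_n)=L_n^{\oplus n}$, $u=(u_1,\dots,u_n)$ acting on $A_n$ by the derivation $\rho(u)(x_i)=[x_i,u_i]$, bracket $[u,v]_i=\rho(u)(v_i)-\rho(v)(u_i)+[u_i,v_i]$. $\mathrm{TAut}(L_n)$ is the (pro-unipotent) group integrating it, with exponential bijection $\exp:\mathrm{tDer}(L_n)\to\mathrm{TAut}(L_n)$: as a set $\exp(L_n)^{\times n}$, $F=(F_1,\dots,F_n)$ acting on $A_n$ by $F(x_i)=F_i^{-1}x_iF_i$,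 product $(F\circ G)_i=F_i\cdot F(G_i)$. Each $a\in A_n$ is uniquely $a=a^0+\sum_ia^ix_i$, $a^0\in\mathbb{K}$, $a^i\in A_n$; $\mathrm{div}(u)=\sum_i|x_i(u_i)^i|$; $j:\mathrm{TAut}(L_n)\to|A_n|$ is the group 1-cocycle with $j(FG)=j(F)+F\cdot j(G)$ and $\frac{d}{dt}j(\exp(tu))|_{t=0}=\mathrm{div}(u)$. Definition of $F^{(n)}$: write $F=\exp(u)$ with $u=(u_1,u_2)\in\mathrm{tDer}(L_2)$, $u_k=u_k(x_1,x_2)$. For $1\le i\le n-1$ let $u^{i,(i+1)\cdots n}\in\mathrm{tDer}(L_n)$ be the element whose first $i-1$ components are $0$, whose $i$th component is $u_1(x_i,x_{i+1}+\cdots+x_n)$, and whose components $i+1,\dots,n$ are all equal to $u_2(x_i,x_{i+1}+\cdots+x_n)$. Put $F^{i,(i+1)\cdots n}=\exp(u^{i,(i+1)\cdots n})$ and $$F^{(n)}=F^{n-1,n}\circ F^{n-2,(n-1)n}\circ\cdots\circ F^{2,3\cdots n}\circ F^{1,2\cdots n}\in\mathrm{TAut}(L_n).$$ *)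

(* Defs.v *)
From HB Require Import structures.
From mathcomp Require Import all_boot all_algebra.
From mathcomp Require Import boolp classical_sets.

Set Implicit Arguments.
Unset Strict Implicit.
Unset Printing Implicit Defensive.

Import GRing.Theory.
Local Open Scope ring_scope.
Local Open Scope quotient_scope.

(** * The algebra A_n *)

(** The degree completion of the free associative algebra: a series is the
    family of its coefficients on words in the letters [x_0, ..., x_(n-1)]. *)
Definition ncps (K : fieldType) (n : nat) : Type := seq 'I_n -> K.

HB.instance Definition _ (K : fieldType) (n : nat) :=
  Choice.copy (ncps K n) (seq 'I_n -> K).

Section Algebra.
Variables (K : fieldType) (n : nat).
Implicit Types (a b c : ncps K n) (w : seq 'I_n).

Definition nc_zero : ncps K n := fun=> 0.
Definition nc_opp a : ncps K n := fun w => - a w.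
Definition nc_add a b : ncps K n := fun w => a w + b w.
Definition nc_scale (k : K) a : ncps K n := fun w => k * a w.
Definition nc_one : ncps K n := fun w => (w == [::])%:R.
Definition nc_mul a b : ncps K n :=
  fun w => \sum_(k < (size w).+1) a (take k w) * b (drop k w).

Fact nc_addA : associative nc_add.
Proof. by move=> a b c; apply/funext => w; exact: addrA. Qed.
Fact nc_addC : commutative nc_add.
Proof. by move=> a b; apply/funext => w; exact: addrC. Qed.
Fact nc_add0 : left_id nc_zero nc_add.
Proof. by move=> a; apply/funext => w; exact: add0r. Qed.
Fact nc_addN : left_inverse nc_zero nc_opp nc_add.
Proof. by move=> a; apply/funext => w; exact: addNr. Qed.

HB.instance Definition _ :=
  GRing.isZmodule.Build (ncps K n) nc_addA nc_addC nc_add0 nc_addN.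

Fact nc_mul_nil a b : nc_mul a b [::] = a [::] * b [::].
Proof. by rewrite /nc_mul big_ord1. Qed.

Fact nc_mul_cons a b i w :
  nc_mul a b (i :: w) =
  a [::] * b (i :: w) + nc_mul (fun v => a (i :: v)) b w.
Proof. by rewrite /nc_mul big_ord_recl. Qed.

Fact nc_mulDl : left_distributive nc_mul +%R.
Proof.
move=> a b c; apply/funext => w; rewrite /nc_mul -[RHS]big_split /=.
by apply: eq_bigr => k _; exact: mulrDl.
Qed.
Fact nc_mulDr : right_distributive nc_mul +%R.
Proof.
move=> a b c; apply/funext => w; rewrite /nc_mul -[RHS]big_split /=.
by apply: eq_bigr => k _; exact: mulrDr.
Qed.
Fact nc_mulZl k a b w : nc_mul (fun v => k * a v) b w = k * nc_mul a b w.
Proof. by rewrite /nc_mul mulr_sumr; apply: eq_bigr => l _; rewrite mulrA. Qed.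
Fact nc_mulA : associative nc_mul.
Proof.
move=> a b c; apply/funext => w; elim: w a b c => [|i w IH] a b c.
  by rewrite !nc_mul_nil mulrA.
rewrite !nc_mul_cons nc_mul_nil mulrDr mulrA -addrA; congr (_ + _).
have -> : (fun v => nc_mul a b (i :: v)) =
  ((fun v => a [::] * b (i :: v)) : ncps K n) + nc_mul (fun v => a (i :: v)) b
  by apply/funext => v; rewrite nc_mul_cons.
by rewrite nc_mulDl IH -nc_mulZl.
Qed.
Fact nc_mul1 : left_id nc_one nc_mul.
Proof.
move=> a; apply/funext => -[|i w]; first by rewrite nc_mul_nil mul1r.
rewrite nc_mul_cons mul1r [X in _ + X]big1 ?addr0 // => k _.
by rewrite mul0r.
Qed.
Fact nc_mulr1 : right_id nc_one nc_mul.
Proof.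
move=> a; apply/funext => w; elim: w a => [|i w IH] a.
  by rewrite nc_mul_nil mulr1.
by rewrite nc_mul_cons mulr0 add0r IH.
Qed.
Fact nc_one_neq0 : nc_one != 0.
Proof. by apply/eqP => /(congr1 (@^~ [::]))/eqP; rewrite oner_eq0. Qed.

HB.instance Definition _ := GRing.Zmodule_isNzRing.Build (ncps K n)
  nc_mulA nc_mul1 nc_mulr1 nc_mulDl nc_mulDr nc_one_neq0.

Fact nc_scaleA k l a : nc_scale k (nc_scale l a) = nc_scale (k * l) a.
Proof. by apply/funext => w; exact: mulrA. Qed.
Fact nc_scale1 : left_id 1 nc_scale.
Proof. by move=> a; apply/funext => w; exact: mul1r. Qed.
Fact nc_scaleDr : right_distributive nc_scale +%R.
Proof. by move=> k a b; apply/funext => w; exact: mulrDr. Qed.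
Fact nc_scaleDl a : {morph nc_scale^~ a : k l / k + l}.
Proof. by move=> k l; apply/funext => w; exact: mulrDl. Qed.

HB.instance Definition _ := GRing.Zmodule_isLmodule.Build K (ncps K n)
  nc_scaleA nc_scale1 nc_scaleDr nc_scaleDl.

Fact nc_scaleAl k a b : k *: (a * b) = k *: a * b.
Proof. by apply/funext => w; rewrite -[LHS]nc_mulZl. Qed.
Fact nc_scaleAr k a b : k *: (a * b) = a * (k *: b).
Proof.
apply/funext => w; rewrite -[LHS]/(k * nc_mul a b w) /nc_mul mulr_sumr.
by apply: eq_bigr => l _; exact: mulrCA.
Qed.

HB.instance Definition _ :=
  GRing.Lmodule_isLalgebra.Build K (ncps K n) nc_scaleAl.
HB.instance Definition _ :=
  GRing.Lalgebra_isAlgebra.Build K (ncps K n) nc_scaleAr.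

Definition ncX (i : 'I_n) : ncps K n := fun w => (w == [:: i])%:R.

Definition brk a b : ncps K n := a * b - b * a.

(** Equality modulo terms of degree [> N]; the closures below are for the
    topology of the degree filtration. *)
Definition agree (N : nat) a b := forall w, (size w <= N)%N -> a w = b w.

(** [ps h a] is [\sum_k h_k a^k] for [h] in [K[[z]]], given by its
    coefficients.  It is the value of the convergent sum when [a] has zero
    constant term, in which case [a ^+ k] vanishes in degrees [< k]; it is
    only used in that case. *)
Definition ps (h : nat -> K) a : ncps K n :=
  fun w => \sum_(k < (size w).+1) h k * (a ^+ k) w.

Definition nexp a : ncps K n := ps (fun k => k`!%:R^-1) a.

(** The term [k = 0] vanishes, as [0^-1 = 0]. *)
Definition nlog a : ncps K n := ps (fun k => (-1) ^+ k.+1 / k%:R) (a - 1).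

Definition ninv a : ncps K n := ps (fun=> 1) (1 - a).

(** The uncompleted free Lie algebra, as the Lie subalgebra generated by the
    letters, and its completion L_n, as the closure of the former. *)
Inductive lie_poly : ncps K n -> Prop :=
| lie_poly0 : lie_poly 0
| lie_polyX i : lie_poly (ncX i)
| lie_polyZD k a b : lie_poly a -> lie_poly b -> lie_poly (k *: a + b)
| lie_poly_brk a b : lie_poly a -> lie_poly b -> lie_poly (brk a b).

Definition Lie a := forall N, exists2 p, lie_poly p & agree N a p.

(** ** The space |A_n| *)

(** Sums of commutators form a K-subspace since [k [a, b] = [k a, b]]. *)
Definition comm_closure : {pred ncps K n} := fun a =>
  `[< forall N, exists s : seq (ncps K n * ncps K n),
        agree N a (\sum_(p <- s) brk p.1 p.2) >].

Fact comm_closure_zmod : zmod_closed comm_closure.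
Proof.
split=> [|a b /asboolP ca /asboolP cb]; apply/asboolP => N.
  by exists [::]; rewrite big_nil.
have [s sa] := ca N; have [t tb] := cb N.
exists (s ++ [seq (- p.1, p.2) | p <- t]) => w wN.
rewrite big_cat big_map /=; congr (_ + _); first exact: sa.
under eq_bigr do rewrite /brk /= mulNr mulrN -opprD.
by rewrite sumrN; congr (- _); exact: tb.
Qed.

HB.instance Definition _ :=
  GRing.isZmodClosed.Build (ncps K n) comm_closure comm_closure_zmod.

Definition cyc := Quotient.quot comm_closure.

Definition tocyc a : cyc := \pi_cyc a.

End Algebra.

(** ** Continuous linear maps, substitutions, derivations *)

(** Continuous linear extension of a map [g] defined on words (monomials).
    It is the value of the convergent sum [\sum_v a_v g(v)] when [g v] vanishes
    in degrees [< size v]. *)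
Definition clin (K : fieldType) (m n : nat) (g : seq 'I_m -> ncps K n)
    (a : ncps K m) : ncps K n :=
  fun w => \sum_(k < (size w).+1) \sum_(v : k.-tuple 'I_m) a v * g v w.

(** [subst f a = a(f_0, ..., f_(m-1))], for [f] with zero constant terms. *)
Definition subst (K : fieldType) (m n : nat) (f : 'I_m -> ncps K n)
    (a : ncps K m) : ncps K n :=
  clin (fun v => \prod_(i <- v) f i) a.

Section Tangential.
Variables (K : fieldType) (n : nat).
Local Notation A := (ncps K n).
Implicit Types (u : 'I_n -> A) (F G : 'I_n -> A).

Definition tDer u := forall i, Lie (u i).

(** The derivation with [x_i |-> [x_i, u_i]], on monomials then on series. *)
Fixpoint der_word u (v : seq 'I_n) : A :=
  if v is i :: v' then
    brk (ncX K i) (u i) * \prod_(j <- v') ncX K j + ncX K i * der_word u v'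
  else 0.

Definition rho u (a : A) : A := clin (der_word u) a.

(** [a = a^0 + \sum_i rcoef i a * x_i]. *)
Definition rcoef (i : 'I_n) (a : A) : A := fun w => a (rcons w i).

Definition divergence u : cyc K n := \sum_i tocyc (ncX K i * rcoef i (u i)).

Definition TAut F := forall i, exists2 l, Lie l & F i = nexp l.

Definition act F (a : A) : A := subst (fun i => ninv (F i) * ncX K i * F i) a.

Definition tcomp F G : 'I_n -> A := fun i => F i * act F (G i).

Definition tid : 'I_n -> A := fun=> 1.

Definition tinv F : 'I_n -> A :=
  xget tid [set G | [/\ TAut G, tcomp F G = tid & tcomp G F = tid]].

(** [act F] preserves the closed span of commutators for [F] in TAut, so the
    choice of a representative is irrelevant. *)
Definition cyc_act F (q : cyc K n) : cyc K n := tocyc (act F (repr q)).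

(** The exponential map.  The maps [a |-> F_i * F(a)], for [F] in TAut, form a
    representation of TAut on A_n, because [(F o G)_i = F_i * F(G_i)]; its
    differential sends [u] to [a |-> u_i * a + rho(u)(a)], and [F_i] is
    recovered as the image of [1].  Hence
    [exp(u)_i = \sum_k (u_i + rho(u))^k (1) / k!], where the terms of index
    [k > size w] do not contribute to the coefficient of [w].  Lemmas [texpD]
    and [texp_velocity] below check that [t |-> texp (t u)] is the
    one-parameter subgroup with velocity [u]. *)
Definition texp u : 'I_n -> A := fun i w =>
  \sum_(k < (size w).+1)
    k`!%:R^-1 * iter k (fun a : A => u i * a + rho u a) 1 w.

(** The defining property of the cocycle [j].  The derivative at [t = 0] is
    taken with [j (exp (t u))] written as the class of a series whose
    coefficients are polynomials in [t]. *)
Definition div_cocycle (j : ('I_n -> A) -> cyc K n) :=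
  (forall F G, TAut F -> TAut G ->
     j (tcomp F G) = j F + cyc_act F (j G)) /\
  (forall u, tDer u -> exists p : seq 'I_n -> {poly K},
     (forall t : K, j (texp (fun i => t *: u i)) =
                    tocyc (fun w => (p w).[t] : K)) /\
     tocyc (fun w => (p w)^`().[0] : K) = divergence u).

End Tangential.

(** ** The elements F^(n) *)

(** [u^{i, (i+1)...n}], with indices starting from [0]. *)
Definition cable (K : fieldType) (n : nat) (u : 'I_2 -> ncps K 2) (i : 'I_n) :
    'I_n -> ncps K n := fun k =>
  let f := fun b : 'I_2 =>
    if b == ord0 then ncX K i else \sum_(l < n | (i < l)%N) ncX K l in
  if (k < i)%N then 0 else if k == i then subst f (u ord0)
  else subst f (u ord_max).

(** [F^(n)] for [F = exp u]: the composition, with the index decreasing from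
    left to right, of the [exp u^{i, (i+1)...n}] for [i] not the last index. *)
Definition Fn (K : fieldType) (n : nat) (u : 'I_2 -> ncps K 2) :
    'I_n -> ncps K n :=
  \big[@tcomp K n/@tid K n]_(i <- rev (enum 'I_n) | (i.+1 < n)%N)
    texp (cable u i).

Arguments Fn {K} n u.

(** ** The exponential is a one-parameter subgroup *)

Section Continuity.
Variables (K : fieldType) (n : nat).
Local Notation A := (ncps K n).
Implicit Types (a b c : A) (v w : seq 'I_n) (S T M R : A -> A).

Lemma nc_addE a b w : (a + b) w = a w + b w. Proof. by []. Qed.
Lemma nc_oppE a w : (- a) w = - a w. Proof. by []. Qed.
Lemma nc_scaleE k a w : (k *: a) w = k * a w. Proof. by []. Qed.
Lemma nc_sumE I (r : seq I) (P : pred I) (f : I -> A) w :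
  (\sum_(i <- r | P i) f i) w = \sum_(i <- r | P i) f i w.
Proof. by elim/big_rec2: _ => // i x y _ <-. Qed.
Lemma nc_mulE a b w :
  (a * b) w = \sum_(k < (size w).+1) a (take k w) * b (drop k w).
Proof. by []. Qed.

Definition vanish d a := forall w, (size w < d)%N -> a w = 0.

Lemma vanish0 d : vanish d 0. Proof. by []. Qed.
Lemma vanishW d e a : (d <= e)%N -> vanish e a -> vanish d a.
Proof. by move=> de ea w wd; apply: ea; apply: leq_trans wd de. Qed.
Lemma vanishD d a b : vanish d a -> vanish d b -> vanish d (a + b).
Proof. by move=> da db w wd; rewrite nc_addE da // db // addr0. Qed.
Lemma vanishM d e a b : vanish d a -> vanish e b -> vanish (d + e) (a * b).
Proof.
move=> da eb w wde; rewrite nc_mulE big1 // => k _.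
have [kd|dk] := ltnP k d.
  by rewrite da ?mul0r // size_takel // -ltnS.
rewrite eb ?mulr0 // size_drop ltn_subLR; last by rewrite -ltnS.
by apply: leq_trans wde _; rewrite leq_add2r.
Qed.
Lemma vanish1X (i : 'I_n) : vanish 1 (ncX K i).
Proof. by case. Qed.

Definition lin T := forall k a b, T (k *: a + b) = k *: T a + T b.

Lemma linD T a b : lin T -> T (a + b) = T a + T b.
Proof. by move=> lT; rewrite -[a]scale1r lT !scale1r. Qed.
Lemma lin0 T : lin T -> T 0 = 0.
Proof. by move=> lT; apply: (addrI (T 0)); rewrite -linD // !addr0. Qed.
Lemma linZ T k a : lin T -> T (k *: a) = k *: T a.
Proof. by move=> lT; rewrite -[k *: a]addr0 lT lin0 // addr0. Qed.
Lemma linB T a b : lin T -> T (a - b) = T a - T b.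
Proof. by move=> lT; rewrite -scaleN1r addrC lT scaleN1r addrC. Qed.
Lemma lin_sum T I (r : seq I) (P : pred I) (f : I -> A) : lin T ->
  T (\sum_(i <- r | P i) f i) = \sum_(i <- r | P i) T (f i).
Proof.
move=> lT; elim/big_rec2: _ => [|i x y _ <-]; first exact: lin0.
exact: linD.
Qed.
Lemma lin_iter T k : lin T -> lin (iter k T).
Proof. by move=> lT; elim: k => // k IH c a b; rewrite /= IH lT. Qed.

(** [T] raises degrees by at least [e]. *)
Definition raises e T := forall d a, vanish d a -> vanish (e + d) (T a).

Lemma raises_iter T k : raises 1 T -> raises k (iter k T).
Proof. by move=> rT; elim: k => // k IH d a /IH /rT. Qed.
Lemma iter_vanish T k a : raises 1 T -> vanish k (iter k T a).
Proof. by move=> rT; have := @raises_iter T k rT 0%N a; rewrite addn0; apply. Qed.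
Lemma lin_agree T d a b : lin T -> raises 0 T -> agree d a b ->
  agree d (T a) (T b).
Proof.
move=> lT rT ab w wd; apply/eqP; rewrite -subr_eq0; apply/eqP.
have: vanish d.+1 (T (a - b)).
  by apply: rT => v vd; rewrite nc_addE ab ?subrr.
by move=> /(_ w wd); rewrite linB.
Qed.

Definition mono v : A := \prod_(i <- v) ncX K i.
Lemma monoE v w : mono v w = (w == v)%:R.
Proof.
rewrite /mono; elim: v w => [|i v IH] w; first by rewrite big_nil.
rewrite big_cons; case: w => [|l w]; first by rewrite [LHS]nc_mul_nil mul0r.
rewrite [LHS]nc_mul_cons mul0r add0r eqseq_cons.
have -> : (fun v => ncX K i (l :: v)) = (l == i)%:R *: 1 :> A.
  apply/funext => x; rewrite nc_scaleE -[(1 : A) x]/((x == [::])%:R).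
  by rewrite /ncX eqseq_cons -natrM mulnb.
by rewrite -[LHS]/(((_ : A) * _) w) -scalerAl mul1r nc_scaleE IH -natrM mulnb.
Qed.

Lemma mono_cat v v' : mono (v ++ v') = mono v * mono v'.
Proof. by rewrite /mono big_cat. Qed.

Lemma mono_approx N a :
  agree N a (\sum_(k < N.+1) \sum_(v : k.-tuple 'I_n) a v *: mono v).
Proof.
move=> w wN; rewrite nc_sumE; have wN' : (size w < N.+1)%N by [].
rewrite (bigD1 (Ordinal wN')) //= nc_sumE (bigD1 (in_tuple w)) //=.
rewrite nc_scaleE monoE eqxx mulr1 !big1 ?addr0 // => [k kw|v vw].
  rewrite nc_sumE big1 // => v _; rewrite nc_scaleE monoE.
  case: eqP => [wv|]; rewrite ?mulr0 //; case/eqP: kw.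
  by apply: val_inj; rewrite /= wv size_tuple.
rewrite nc_scaleE monoE; case: eqP => [wv|]; rewrite ?mulr0 //.
by case/eqP: vw; apply: val_inj.
Qed.

Lemma lin_ext S T : lin S -> raises 0 S -> lin T -> raises 0 T ->
  (forall v, S (mono v) = T (mono v)) -> S =1 T.
Proof.
move=> lS rS lT rT ST a; apply/funext => w.
have aP := @mono_approx (size w) a.
rewrite (lin_agree lS rS aP) // (lin_agree lT rT aP) //; congr (_ w).
rewrite !lin_sum //; apply: eq_bigr => k _; rewrite !lin_sum //.
by apply: eq_bigr => v _; rewrite !linZ // ST.
Qed.

Section Clin.
Variables (e : nat) (g : seq 'I_n -> A).
Hypothesis gv : forall v, vanish (e + size v) (g v).

Lemma clinE N a w : (size w <= N)%N ->
  clin g a w = \sum_(k < N.+1) \sum_(v : k.-tuple 'I_n) a v * g v w.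
Proof.
move=> wN; rewrite /clin.
rewrite -(subnKC wN) -addSn big_split_ord /= [X in _ + X]big1 ?addr0 // => k _.
rewrite big1 // => v _; rewrite gv ?mulr0 // size_tuple.
by apply: leq_trans (leq_addl _ _); rewrite addSn ltnS leq_addr.
Qed.

Lemma clin_lin : lin (clin g).
Proof.
move=> k a b; apply/funext => w; rewrite nc_addE nc_scaleE /clin.
rewrite mulr_sumr -big_split; apply: eq_bigr => l _.
rewrite mulr_sumr -big_split; apply: eq_bigr => v _.
by rewrite nc_addE nc_scaleE /= mulrDl mulrA.
Qed.

Lemma clin_raises : raises e (clin g).
Proof.
move=> d a da w wd; rewrite /clin big1 // => k _; rewrite big1 // => v _.
have [kd|dk] := ltnP k d; first by rewrite da ?mul0r // size_tuple.
rewrite gv ?mulr0 // size_tuple; apply: leq_trans wd _.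
by rewrite leq_add2l.
Qed.

Lemma clin_mono v : clin g (mono v) = g v.
Proof.
apply/funext => w; rewrite (clinE _ (leq_maxl _ (size v))).
have vN : (size v < (maxn (size w) (size v)).+1)%N by rewrite ltnS leq_maxr.
rewrite (bigD1 (Ordinal vN)) //= (bigD1 (in_tuple v)) //=.
rewrite monoE eqxx mul1r !big1 ?addr0 // => [k kv|x xv].
  rewrite big1 // => x _; rewrite monoE; case: eqP => [xv|]; rewrite ?mul0r //.
  by case/eqP: kv; apply: val_inj => /=; rewrite -[LHS](size_tuple x) xv.
rewrite monoE; case: eqP => [xe|]; rewrite ?mul0r //.
by case/eqP: xv; apply: val_inj.
Qed.
End Clin.

Lemma sum_triangle (V : nmodType) N (c : nat -> nat -> V) :
  (forall k l, (N < k + l)%N -> c k l = 0) ->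
  \sum_(k < N.+1) \sum_(l < N.+1) c k l =
  \sum_(m < N.+1) \sum_(k < m.+1) c k (m - k)%N.
Proof.
move=> c0.
have -> : \sum_(m < N.+1) \sum_(k < m.+1) c k (m - k)%N =
  \sum_(m < N.+1) \sum_(k < N.+1 | (k <= m)%N) c k (m - k)%N.
  apply: eq_bigr => m _.
  by rewrite (big_ord_widen N.+1 (fun k => c k (m - k)%N)) // => //; apply: ltn_ord.
rewrite [RHS](exchange_big_dep xpredT) //=; apply: eq_bigr => k _.
have kN : (k <= N)%N by rewrite -ltnS.
transitivity (\sum_(0 <= l < N.+1) c k l).
  by rewrite big_mkord.
transitivity (\sum_(k <= m < N.+1) c k (m - k)%N); last first.
  by rewrite big_geq_mkord.
have := big_addn 0 N.+1 k xpredT (fun m => c k (m - k)%N); rewrite add0n => ->.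
rewrite (big_cat_nat (n := (N.+1 - k)%N)) ?leq_subr //=.
rewrite [X in _ + X]big_nat_cond [X in _ + X]big1 ?addr0; last first.
  by move=> i /andP[/andP[ki _] _]; apply: c0; rewrite leq_subLR in ki.
by apply: eq_bigr => i _; rewrite addnK.
Qed.

(** [exp(t M)(a)], for [M] raising degrees by one. *)
Definition opexp M (t : K) a : A := fun w =>
  \sum_(k < (size w).+1) t ^+ k / k`!%:R * iter k M a w.

Lemma opexpE M t a N : raises 1 M ->
  agree N (opexp M t a) (\sum_(k < N.+1) (t ^+ k / k`!%:R) *: iter k M a).
Proof.
move=> rM w wN; rewrite nc_sumE /opexp -(subnKC wN) -addSn big_split_ord /=.
rewrite [X in _ = _ + X]big1 ?addr0 // => k _.
rewrite nc_scaleE -iterS (@iter_vanish M _ a rM) ?mulr0 //.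
by rewrite ltnS leq_addr.
Qed.

Lemma opexp_lin M t : lin M -> lin (opexp M t).
Proof.
move=> lM k a b; apply/funext => w; rewrite nc_addE nc_scaleE /opexp.
rewrite mulr_sumr -big_split; apply: eq_bigr => l _.
by rewrite lin_iter // nc_addE nc_scaleE /= mulrDr mulrCA.
Qed.

Lemma opexp_raises M t : raises 1 M -> raises 0 (opexp M t).
Proof.
move=> rM d a da w wd; rewrite /opexp big1 // => k _.
rewrite (raises_iter (k := k) rM da) ?mulr0 //.
by apply: leq_trans wd _; rewrite leq_add2r.
Qed.

Lemma opexp_nil M t a : opexp M t a [::] = a [::].
Proof. by rewrite /opexp big_ord1 /= divff ?oner_eq0 // mul1r. Qed.

Hypothesis charK : [pchar K] =i pred0.

Lemma inv_bin_fact (m : nat) (k : 'I_m.+1) :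
  'C(m, k)%:R / m`!%:R = k`!%:R^-1 * (m - k)`!%:R^-1 :> K.
Proof.
have fact0 q : q`!%:R != 0 :> K.
  by rewrite ((pcharf0P K).1 charK) -lt0n fact_gt0.
have km : (k <= m)%N by rewrite -ltnS.
by rewrite -(bin_fact km) !natrM invfM mulrA divff ?mul1r ?invfM //
  ((pcharf0P K).1 charK) -lt0n bin_gt0.
Qed.

Lemma opexpD M s t a : lin M -> raises 1 M ->
  opexp M (s + t) a = opexp M s (opexp M t a).
Proof.
move=> lM rM; apply/funext => w; set N := size w.
have rI k : raises 0 (iter k M).
  by move=> d b /(raises_iter (k := k) rM); apply: vanishW; exact: leq_addl.
rewrite [RHS](_ : _ = \sum_(k < N.+1) \sum_(l < N.+1)
   (s ^+ k / k`!%:R) * (t ^+ l / l`!%:R) * iter (k + l) M a w); last first.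
  apply: eq_bigr => k _.
  rewrite (lin_agree (lin_iter _ lM) (rI _) (opexpE (N := N) _ _ rM)) //.
  rewrite lin_sum; last exact: lin_iter.
  rewrite nc_sumE mulr_sumr; apply: eq_bigr => l _.
  by rewrite linZ ?nc_scaleE ?iterD ?mulrA //; exact: lin_iter.
rewrite (sum_triangle (c := fun k l => s ^+ k / k`!%:R * (t ^+ l / l`!%:R) *
  iter (k + l) M a w)); last first.
  by move=> k l Nkl; rewrite (iter_vanish _ rM) ?mulr0.
apply: eq_bigr => m _; rewrite addrC exprDn !mulr_suml; apply: eq_bigr => k _.
rewrite subnKC; last by rewrite -ltnS.
congr (_ * _).
by rewrite -mulr_natr -[LHS]mulrA inv_bin_fact [X in X * _]mulrC mulrACA.
Qed.

Lemma pascal_sum (m : nat) (f : nat -> A) :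
  \sum_(k < m.+2) 'C(m.+1, k)%:R *: f k =
  \sum_(k < m.+1) 'C(m, k)%:R *: f k + \sum_(k < m.+1) 'C(m, k)%:R *: f k.+1
  :> A.
Proof.
rewrite big_ord_recl bin0.
under eq_bigr => k _ do rewrite lift0 binS natrD scalerDl.
rewrite big_split /= addrA; congr (_ + _).
have := big_ord_recl m.+1 (fun k : 'I_m.+2 => 'C(m, k)%:R *: f k : A).
rewrite bin0 /= => <-.
by rewrite big_ord_recr /= bin_small // scale0r addr0.
Qed.

Lemma opexpM M R t a b : lin M -> raises 1 M -> lin R -> raises 1 R ->
  (forall a b, M (a * b) = M a * b + a * R b) ->
  opexp M t (a * b) = opexp M t a * opexp R t b.
Proof.
move=> lM rM lR rR MR; apply/funext => w; set N := size w.
have iM m : iter m M (a * b) =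
    \sum_(k < m.+1) 'C(m, k)%:R *: (iter k M a * iter (m - k) R b).
  elim: m => [|m IH]; first by rewrite big_ord1 scale1r.
  rewrite iterS IH lin_sum // (pascal_sum m
    (fun k => iter k M a * iter (m.+1 - k) R b)) -big_split /=.
  apply: eq_bigr => k _; rewrite linZ // MR scalerDr addrC; congr (_ + _).
  by rewrite subSn // -ltnS.
rewrite [RHS](_ : _ = \sum_(k < N.+1) \sum_(l < N.+1)
   (t ^+ k / k`!%:R) * (t ^+ l / l`!%:R) * (iter k M a * iter l R b) w); last first.
  transitivity (((\sum_(k < N.+1) (t ^+ k / k`!%:R) *: iter k M a) *
                (\sum_(k < N.+1) (t ^+ k / k`!%:R) *: iter k R b)) w).
    rewrite !nc_mulE; apply: eq_bigr => k _.
    rewrite (opexpE (N := N) _ _ rM) ?(opexpE (N := N) _ _ rR) //.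
      by rewrite size_drop leq_subr.
    by rewrite size_take_min geq_minr.
  rewrite mulr_suml nc_sumE; apply: eq_bigr => k _.
  rewrite mulr_sumr nc_sumE; apply: eq_bigr => l _.
  by rewrite -scalerAl -scalerAr scalerA.
rewrite (sum_triangle (c := fun k l => t ^+ k / k`!%:R * (t ^+ l / l`!%:R) *
  (iter k M a * iter l R b) w)); last first.
  move=> k l Nkl; rewrite (vanishM (d := k) (e := l)) ?mulr0 //;
    exact: iter_vanish.
apply: eq_bigr => m _; rewrite iM nc_sumE mulr_sumr; apply: eq_bigr => k _.
rewrite nc_scaleE !mulrA; congr (_ * _).
have km : (k <= m)%N by rewrite -ltnS.
rewrite -mulrA [_^-1 * _]mulrC inv_bin_fact -{1}(subnKC km) exprD -!mulrA.
by congr (_ * _); rewrite mulrCA.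
Qed.

End Continuity.

Section OneParameter.
Variables (K : fieldType) (n : nat).
Local Notation A := (ncps K n).

Lemma ninvM (a : A) : a [::] = 1 -> ninv a * a = 1.
Proof.
move=> a1; set b := 1 - a.
have b0 : vanish 1 b by case=> // _; rewrite /b nc_addE nc_oppE a1 subrr.
have bk k : vanish k (b ^+ k).
  by elim: k => // k IH; rewrite exprS -add1n; apply: vanishM.
have -> : a = 1 - b by rewrite opprB addrC subrK.
apply/funext => w; set N := size w.
have -> : (ninv (1 - b) * (1 - b)) w =
    ((\sum_(k < N.+1) b ^+ k) * (1 - b)) w.
  rewrite !nc_mulE; apply: eq_bigr => k _; congr (_ * _).
  have sk : (size (take k w) <= N)%N by rewrite size_take_min geq_minr.
  rewrite /ninv opprB addrC subrK /ps nc_sumE -(subnKC sk) -addSn big_split_ord /=.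
  under eq_bigr do rewrite mul1r.
  rewrite [X in _ = _ + X]big1 ?addr0 // => l _; apply: bk.
  by rewrite addSn ltnS leq_addr.
have -> : (\sum_(k < N.+1) b ^+ k) * (1 - b) = 1 - b ^+ N.+1.
  rewrite mulrBr mulr1 mulr_suml; under [X in _ - X]eq_bigr do rewrite -exprSr.
  by rewrite big_ord_recl [X in _ - X]big_ord_recr /= expr0 opprD addrA addrK.
by rewrite nc_addE nc_oppE bk // oppr0 addr0.
Qed.

Lemma lie_nil (a : A) : Lie a -> a [::] = 0.
Proof.
move=> /(_ 0%N)[p lp /(_ [::] isT) ->]; elim: lp => //.
  by move=> k b c _ b0 _ c0; rewrite nc_addE nc_scaleE b0 c0 mulr0 addr0.
move=> b c _ b0 _ c0; rewrite /brk nc_addE nc_oppE.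
by rewrite -[(b * c) _]/(nc_mul b c _) -[(c * b) _]/(nc_mul c b _) !nc_mul_nil
  b0 c0 !mul0r subrr.
Qed.

Variable u : 'I_n -> A.
Hypothesis u0 : forall i, u i [::] = 0.

Lemma u_vanish i : vanish 1 (u i).
Proof. by case=> // _; apply: u0. Qed.

Lemma monoS i v : @mono K n (i :: v) = ncX K i * @mono K n v.
Proof. by rewrite /mono big_cons. Qed.

Lemma mono_vanish (v : seq 'I_n) : vanish (size v) (@mono K n v).
Proof.
by elim: v => // i v IH; rewrite monoS; apply: (@vanishM _ _ 1) => //; apply: vanish1X.
Qed.

Lemma der_word_vanish v : vanish (1 + size v) (der_word u v).
Proof.
elim: v => [|i v IH] /=; first by [].
apply: vanishD; last by rewrite addnS; apply: (@vanishM _ _ 1) => //; apply: vanish1X.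
rewrite -addSnnS; apply: vanishM; last exact: mono_vanish.
apply: vanishD; first by apply: (@vanishM _ _ 1 1); [apply: vanish1X|apply: u_vanish].
move=> w w2; rewrite nc_oppE.
rewrite (@vanishM _ _ 1 1) ?oppr0 //; first exact: u_vanish.
exact: vanish1X.
Qed.

Lemma rho_lin : lin (rho u). Proof. exact: clin_lin. Qed.
Lemma rho_raises : raises 1 (rho u).
Proof. by apply: clin_raises => v; apply: der_word_vanish. Qed.
Lemma raises10 (T : A -> A) : raises 1 T -> raises 0 T.
Proof. by move=> rT d a /rT; apply: vanishW; rewrite add0n. Qed.
Lemma rho_mono v : rho u (@mono K n v) = der_word u v.
Proof. by apply: (@clin_mono _ _ 1) => x; apply: der_word_vanish. Qed.

Lemma der_word_cat v v' :
  der_word u (v ++ v') = der_word u v * @mono K n v' + @mono K n v * der_word u v'.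
Proof.
elim: v => [|i v IH] /=; first by rewrite mul0r add0r /mono big_nil mul1r.
by rewrite IH -/(@mono K n _) mono_cat monoS !mulrDl !mulrDr !mulrA addrA.
Qed.

Lemma raises_mull (a : A) (T : A -> A) : raises 0 T -> raises 0 (fun b => a * T b).
Proof. by move=> rT d b /rT; rewrite !add0n => Tb; apply: (@vanishM _ _ 0). Qed.
Lemma raises_mulr (a : A) (T : A -> A) : raises 0 T -> raises 0 (fun b => T b * a).
Proof.
move=> rT d b /rT; rewrite !add0n => Tb.
by rewrite -[d]addn0; apply: (@vanishM _ _ d 0).
Qed.
Lemma raisesD e (S T : A -> A) : raises e S -> raises e T ->
  raises e (fun b => S b + T b).
Proof. by move=> rS rT d b db; apply: vanishD; [apply: rS|apply: rT]. Qed.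
Lemma raises_id : raises 0 (id : A -> A). Proof. by []. Qed.

Lemma rhoM a b : rho u (a * b) = rho u a * b + a * rho u b.
Proof.
have r0 := raises10 rho_raises.
move: a; apply: lin_ext => [k x y||k x y||v].
- by rewrite mulrDl -scalerAl rho_lin.
- by move=> d x dx; apply: r0; exact: (raises_mulr b raises_id).
- by rewrite rho_lin !mulrDl -!scalerAl scalerDr addrACA.
- apply: raisesD; first exact: raises_mulr.
  exact: (raises_mulr _ raises_id).
move: b; apply: lin_ext => [k x y||k x y||v'].
- by rewrite mulrDr -scalerAr rho_lin.
- by move=> d x dx; apply: r0; exact: (raises_mull _ raises_id).
- by rewrite rho_lin !mulrDr -!scalerAr scalerDr addrACA.
- by apply: raisesD; [apply: (raises_mull _ raises_id)|apply: raises_mull].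
by rewrite -mono_cat !rho_mono der_word_cat.
Qed.

Let M i (a : A) : A := u i * a + rho u a.

Lemma M_lin i : lin (M i).
Proof. by move=> k a b; rewrite /M mulrDr -scalerAr rho_lin scalerDr addrACA. Qed.
Lemma M_raises i : raises 1 (M i).
Proof.
apply: raisesD; last exact: rho_raises.
by move=> d a da; apply: vanishM => //; apply: u_vanish.
Qed.
Lemma M_mul i a b : M i (a * b) = M i a * b + a * rho u b.
Proof. by rewrite /M rhoM mulrDl !mulrA addrA. Qed.

Lemma rho1 : rho u 1 = 0.
Proof. by have := rho_mono [::]; rewrite /mono big_nil. Qed.
Lemma rhoX i : rho u (ncX K i) = brk (ncX K i) (u i).
Proof.
have := rho_mono [:: i]; rewrite /mono big_seq1 => ->.
by rewrite /= big_nil mulr1 mulr0 addr0.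
Qed.

Lemma rhoZ t a : rho (fun i => t *: u i) a = t *: rho u a.
Proof.
apply/funext => w; rewrite nc_scaleE /rho /clin mulr_sumr; apply: eq_bigr => k _.
rewrite mulr_sumr; apply: eq_bigr => v _; rewrite mulrCA; congr (_ * _).
rewrite -nc_scaleE; congr (_ w); elim: {v} (val v) => [|i v IH] /=.
  by rewrite scaler0.
by rewrite IH /brk -!scalerAr -!scalerAl -scalerBr -scalerAl scalerDr.
Qed.

Lemma texpE t i : texp (fun i => t *: u i) i = opexp (M i) t 1.
Proof.
apply/funext => w; apply: eq_bigr => k _.
suff -> : iter k (fun a : A => t *: u i * a + rho (fun i => t *: u i) a) 1 =
    t ^+ k *: iter k (M i) 1 by rewrite nc_scaleE mulrA [_^-1 * _]mulrC.
elim: (val k) => [|m IH]; first by rewrite scale1r.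
rewrite /= IH rhoZ -scalerAl -scalerDr exprS -scalerA; congr (_ *: _).
by rewrite -[LHS]/(M i _) (linZ _ _ (M_lin i)).
Qed.

Hypothesis charK : [pchar K] =i pred0.

Lemma act_texp t : act (texp (fun i => t *: u i)) =1 opexp (rho u) t.
Proof.
set F := texp _.
have FX i : ninv (F i) * ncX K i * F i = opexp (rho u) t (ncX K i).
  rewrite -[RHS]mul1r -(@ninvM (F i)); last by rewrite /F texpE opexp_nil.
  rewrite -!mulrA; congr (_ * _); rewrite {2}/F texpE.
  rewrite -(opexpM charK t 1 (ncX K i) (M_lin i) (@M_raises i) rho_lin rho_raises (M_mul i)).
  rewrite mul1r; apply/funext => w; rewrite /F texpE.
  have XM k : iter k (M i) (ncX K i) = ncX K i * iter k (M i) 1.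
    elim: k => [|k IH]; first by rewrite mulr1.
    by rewrite /= IH {1}/M rhoM rhoX /brk mulrBl /M mulrDr !mulrA addrA
      [X in X + _]addrC subrK.
  transitivity ((ncX K i * \sum_(k < (size w).+1) (t ^+ k / k`!%:R) *: iter k (M i) 1) w).
    rewrite !nc_mulE; apply: eq_bigr => k _; congr (_ * _).
    by rewrite (opexpE (N := size w) _ _ (@M_raises i)) // size_drop leq_subr.
  rewrite mulr_sumr nc_sumE; apply: eq_bigr => k _.
  by rewrite XM -scalerAr nc_scaleE.
have fv v : vanish (0 + size v) (\prod_(i <- v) (ninv (F i) * ncX K i * F i)).
  elim: v => // i v IH; rewrite big_cons; apply: (@vanishM _ _ 1) => //.
  rewrite -[1%N]/(0 + 1 + 0)%N; apply: vanishM => //; apply: vanishM => //.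
  exact: vanish1X.
apply: lin_ext.
- exact: clin_lin.
- exact: clin_raises.
- exact: opexp_lin rho_lin.
- exact: opexp_raises rho_raises.
move=> v; rewrite /act /subst (clin_mono fv).
elim: v => [|i v IH].
  rewrite /mono !big_nil; apply/funext => w; rewrite /opexp big_ord_recl /=.
  rewrite divff ?oner_eq0 // mul1r big1 ?addr0 // => k _.
  rewrite -iterS iterSr rho1 lin0 ?mulr0 //; exact: lin_iter rho_lin.
rewrite big_cons IH monoS FX.
by rewrite (opexpM charK t _ _ rho_lin rho_raises rho_lin rho_raises rhoM).
Qed.

End OneParameter.

Lemma texpD (K : fieldType) (n : nat) (u : 'I_n -> ncps K n) (s t : K) :
  [pchar K] =i pred0 -> tDer u ->
  texp (fun i => (s + t) *: u i) =
  tcomp (texp (fun i => s *: u i)) (texp (fun i => t *: u i)).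
Proof.
move=> charK Lu; have u0 i := lie_nil (Lu i).
apply/funext => i; rewrite /tcomp act_texp // !texpE //.
rewrite (opexpD charK _ _ _ (M_lin u i) (@M_raises _ _ _ u0 i)).
rewrite -{1}[opexp _ t 1]mul1r.
by rewrite (opexpM charK _ _ _ (M_lin u i) (@M_raises _ _ _ u0 i) (rho_lin u)
  (rho_raises u0) (M_mul u0 i)).
Qed.

Lemma texp_velocity (K : fieldType) (n : nat) (u : 'I_n -> ncps K n) :
  tDer u -> exists p : 'I_n -> seq 'I_n -> {poly K},
  (forall t i w, texp (fun i => t *: u i) i w = (p i w).[t]) /\
  (forall i w, (p i w)^`().[0] = u i w).
Proof.
move=> Lu; have u0 i := lie_nil (Lu i).
exists (fun i w => \poly_(k < (size w).+1)
  (k`!%:R^-1 * iter k (fun a => u i * a + rho u a) 1 w)); split=> [t i w|i w].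
  rewrite texpE // horner_poly; apply: eq_bigr => k _.
  by rewrite [RHS]mulrC mulrA.
rewrite horner_coef0 coef_deriv mulr1n coef_poly; case: ifP => [_|].
  by rewrite /= rho1 // mulr1 addr0 invr1 mul1r.
by case: w => // _; rewrite u0.
Qed.

(* Main.v *)
Require Import Defs.
From mathcomp Require Import all_boot all_algebra.
From mathcomp Require Import boolp classical_sets.

(** The element [F^(n)] multiplies out the Baker-Campbell-Hausdorff product one
    variable at a time, and [j((F^(n))^-1)] telescopes, because the inverse of
    [F^{i, (i+1)...n}] conjugates all the later variables by one and the same
    element and therefore fixes the cyclic classes of their power series.  For
    the value of [j] on a factor: [d/dt j(exp(t u)) = exp(t rho(u)) div(u)]
    yields [j(exp u) = \int_0^1 exp(t rho(u)) div(u) dt], and both [rho] and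
    [div] are compatible with the substitution [x_1 |-> x_i],
    [x_2 |-> x_(i+1) + ... + x_n].

    That the elements involved belong to [TAut] rests on a criterion that
    replaces the BCH theorem: if [E] is the Euler (degree) derivation and [g]
    has constant term [1], then [g] is the exponential of a Lie series if and
    only if [g^-1 E(g)] is a Lie series.  For [M = log g] this follows from
    [E(e^M) = e^M \sum_j (-ad M)^j (E(M)) / (j+1)!] by induction on the degree. *)

Set Implicit Arguments.
Unset Strict Implicit.
Unset Printing Implicit Defensive.

Import GRing.Theory.
Local Open Scope ring_scope.
Local Open Scope quotient_scope.

Section Agree.
Variables (K : fieldType) (n : nat).
Local Notation A := (ncps K n).
Implicit Types (a b c : A) (N : nat).

Lemma agree_refl N a : agree N a a. Proof. by []. Qed.

Lemma agree_sym N a b : agree N a b -> agree N b a.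
Proof. by move=> ab w wN; rewrite ab. Qed.

Lemma agree_trans N a b c : agree N a b -> agree N b c -> agree N a c.
Proof. by move=> ab bc w wN; rewrite ab // bc. Qed.

Lemma agreeW N M a b : (N <= M)%N -> agree M a b -> agree N a b.
Proof. by move=> NM ab w wN; apply: ab; apply: leq_trans wN NM. Qed.

Lemma agree_eq a b : (forall N, agree N a b) -> a = b.
Proof. by move=> ab; apply/funext => w; apply: (ab (size w)). Qed.

Lemma agreeB N a b : agree N a b <-> vanish N.+1 (a - b).
Proof.
split=> ab w wN; first by rewrite nc_addE nc_oppE ab ?subrr.
by apply/eqP; rewrite -subr_eq0; apply/eqP; exact: ab.
Qed.

Lemma agree0 N a : agree N a 0 <-> vanish N.+1 a.
Proof. by rewrite agreeB subr0. Qed.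

Lemma agreeD N a b a' b' :
  agree N a a' -> agree N b b' -> agree N (a + b) (a' + b').
Proof. by move=> aa bb w wN; rewrite !nc_addE aa ?bb. Qed.

Lemma agreeN N a a' : agree N a a' -> agree N (- a) (- a').
Proof. by move=> aa w wN; rewrite !nc_oppE aa. Qed.

Lemma agreeZ N k a a' : agree N a a' -> agree N (k *: a) (k *: a').
Proof. by move=> aa w wN; rewrite !nc_scaleE aa. Qed.

Lemma agreeM N a b a' b' :
  agree N a a' -> agree N b b' -> agree N (a * b) (a' * b').
Proof.
move=> aa bb w wN; rewrite !nc_mulE; apply: eq_bigr => k _.
rewrite aa ?bb //; first by rewrite size_drop; apply: leq_trans (leq_subr _ _) wN.
by rewrite size_take_min; apply: leq_trans (geq_minr _ _) wN.
Qed.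

Lemma agree_sum N I (r : seq I) (P : pred I) (f g : I -> A) :
  (forall i, P i -> agree N (f i) (g i)) ->
  agree N (\sum_(i <- r | P i) f i) (\sum_(i <- r | P i) g i).
Proof.
by move=> fg w wN; rewrite !nc_sumE; apply: eq_bigr => i Pi; apply: fg.
Qed.

Lemma agree_brk N a b a' b' :
  agree N a a' -> agree N b b' -> agree N (brk a b) (brk a' b').
Proof. by move=> aa bb; apply: agreeD (agreeN _); apply: agreeM. Qed.

Lemma vanish1P a : vanish 1 a <-> a [::] = 0.
Proof. by split=> [->//|a0] []. Qed.

Lemma vanishX a k : vanish 1 a -> vanish k (a ^+ k).
Proof. by move=> a0; elim: k => // k IH; rewrite exprS -add1n; apply: vanishM. Qed.

Lemma vanishN d a : vanish d a -> vanish d (- a).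
Proof. by move=> da w wd; rewrite nc_oppE da ?oppr0. Qed.

Lemma vanishZ d k a : vanish d a -> vanish d (k *: a).
Proof. by move=> da w wd; rewrite nc_scaleE da ?mulr0. Qed.

Lemma vanish_brk d e a b : vanish d a -> vanish e b -> vanish (d + e) (brk a b).
Proof.
move=> da eb; apply: vanishD; first exact: vanishM.
by apply: vanishN; rewrite addnC; apply: vanishM.
Qed.

Lemma nc_mul0E a b : (a * b) [::] = a [::] * b [::].
Proof. exact: nc_mul_nil. Qed.

Lemma nc_oneE w : (1 : A) w = (w == [::])%:R. Proof. by []. Qed.

(** The value of the convergent sum [\sum_k f k] when [f k] vanishes in degrees
    [< k], which is the only case in which it is used. *)
Definition csum (f : nat -> A) : A := fun w => \sum_(k < (size w).+1) f k w.

Lemma csum_agree (f : nat -> A) N : (forall k, vanish k (f k)) ->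
  agree N (csum f) (\sum_(k < N.+1) f k).
Proof.
move=> fv w wN; rewrite nc_sumE /csum -(subnKC wN) -addSn big_split_ord /=.
rewrite [X in _ = _ + X]big1 ?addr0 // => k _; apply: fv.
by rewrite addSn ltnS leq_addr.
Qed.
End Agree.

Section Clinear.
Variable K : fieldType.

Definition clinear m n (T : ncps K m -> ncps K n) :=
  (forall k a b, T (k *: a + b) = k *: T a + T b) /\
  (forall N a b, agree N a b -> agree N (T a) (T b)).

Section Theory.
Variables (m n : nat) (T : ncps K m -> ncps K n) (cT : clinear T).

Lemma clinearD a b : T (a + b) = T a + T b.
Proof. by rewrite -[a]scale1r cT.1 !scale1r. Qed.
Lemma clinear0 : T 0 = 0.
Proof. by apply: (addrI (T 0)); rewrite -clinearD !addr0. Qed.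
Lemma clinearZ k a : T (k *: a) = k *: T a.
Proof. by rewrite -[k *: a]addr0 cT.1 clinear0 addr0. Qed.
Lemma clinearN a : T (- a) = - T a.
Proof. by rewrite -scaleN1r clinearZ scaleN1r. Qed.
Lemma clinearB a b : T (a - b) = T a - T b.
Proof. by rewrite clinearD clinearN. Qed.
Lemma clinear_sum I (r : seq I) (P : pred I) (f : I -> ncps K m) :
  T (\sum_(i <- r | P i) f i) = \sum_(i <- r | P i) T (f i).
Proof. by apply: (big_morph T clinearD); exact: clinear0. Qed.
Lemma clinear_agree N a b : agree N a b -> agree N (T a) (T b).
Proof. exact: cT.2. Qed.
Lemma clinear_vanish N a : vanish N a -> vanish N (T a).
Proof.
case: N => // N av; apply: (iffLR (agree0 _ _)); rewrite -clinear0.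
apply: clinear_agree => //; exact: (iffRL (agree0 _ _)).

Qed.
End Theory.

Lemma clinear_ext m n (S T : ncps K m -> ncps K n) :
  clinear S -> clinear T -> (forall v, S (mono K v) = T (mono K v)) -> S =1 T.
Proof.
move=> cS cT ST a; apply: agree_eq => N; have aN := @mono_approx K m N a.
apply: agree_trans (clinear_agree cS aN) _.
apply: agree_trans (agree_sym (clinear_agree cT aN)).
rewrite !clinear_sum //; apply: agree_sum => k _; rewrite !clinear_sum //.
by apply: agree_sum => v _; rewrite !clinearZ // ST.
Qed.

Lemma clinear_comp l m n (S : ncps K m -> ncps K n) (T : ncps K l -> ncps K m) :
  clinear S -> clinear T -> clinear (fun a => S (T a)).
Proof.
move=> cS cT; split=> [k a b|N a b ab]; first by rewrite cT.1 cS.1.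
exact/cS.2/cT.2.
Qed.

Lemma clinear_id n : clinear (fun a : ncps K n => a). Proof. by []. Qed.

Lemma clinear_add m n (S T : ncps K m -> ncps K n) :
  clinear S -> clinear T -> clinear (fun a => S a + T a).
Proof.
move=> cS cT; split=> [k a b|N a b ab]; first by rewrite cT.1 cS.1 scalerDr addrACA.
by apply: agreeD; [apply: cS.2|apply: cT.2].
Qed.

Lemma clinear_opp m n (T : ncps K m -> ncps K n) :
  clinear T -> clinear (fun a => - T a).
Proof.
move=> cT; split=> [k a b|N a b ab]; first by rewrite cT.1 opprD scalerN.
by apply: agreeN; apply: cT.2.
Qed.

Lemma clinear_mull m n (c : ncps K n) (T : ncps K m -> ncps K n) :
  clinear T -> clinear (fun a => c * T a).
Proof.
move=> cT; split=> [k a b|N a b ab]; first by rewrite cT.1 mulrDr scalerAr.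
by apply: agreeM => //; apply: cT.2.
Qed.

Lemma clinear_mulr m n (c : ncps K n) (T : ncps K m -> ncps K n) :
  clinear T -> clinear (fun a => T a * c).
Proof.
move=> cT; split=> [k a b|N a b ab]; first by rewrite cT.1 mulrDl scalerAl.
by apply: agreeM => //; apply: cT.2.
Qed.

Lemma clinear_raises n (T : ncps K n -> ncps K n) :
  lin T -> raises 0 T -> clinear T.
Proof. by move=> lT rT; split=> // N a b; apply: lin_agree. Qed.

Lemma clinear_clin m n (g : seq 'I_m -> ncps K n) : clinear (clin g).
Proof.
split=> [k a b|N a b ab w wN].
  apply/funext => w; rewrite nc_addE nc_scaleE /clin.
  rewrite mulr_sumr -big_split; apply: eq_bigr => l _.
  rewrite mulr_sumr -big_split; apply: eq_bigr => v _.
  by rewrite nc_addE nc_scaleE /= mulrDl mulrA.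
apply: eq_bigr => k _; apply: eq_bigr => v _; rewrite ab // size_tuple.
by apply: leq_trans wN; rewrite -ltnS.
Qed.

Lemma clin_word m n (g : seq 'I_m -> ncps K n) v :
  (forall v, vanish (size v) (g v)) -> clin g (mono K v) = g v.
Proof.
move=> gv; apply/funext => w; rewrite /clin.
have z (x : seq 'I_m) : x <> v -> (mono K v : ncps K m) x = 0.
  by rewrite monoE => /eqP/negbTE ->.
have [wv|vw] := ltnP (size w) (size v).
  rewrite gv // big1 // => k _; rewrite big1 // => x _.
  rewrite z ?mul0r // => xv; move: wv; rewrite -xv size_tuple => wk.
  by have := ltn_ord k; rewrite ltnS leqNgt wk.
have vN : (size v < (size w).+1)%N by rewrite ltnS.
rewrite (bigD1 (Ordinal vN)) //= (bigD1 (in_tuple v)) //=.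
rewrite monoE eqxx mul1r !big1 ?addr0 // => [k kv|x xv].
  rewrite big1 // => x _; rewrite z ?mul0r // => xv.
  by case/eqP: kv; apply: val_inj => /=; rewrite -xv size_tuple.
by rewrite z ?mul0r // => xe; case/eqP: xv; apply: val_inj.
Qed.

(** * Continuous algebra morphisms *)

Definition cmorph m n (T : ncps K m -> ncps K n) :=
  [/\ clinear T, T 1 = 1 & {morph T : a b / a * b}].

Lemma cmorphX m n (T : ncps K m -> ncps K n) a k :
  cmorph T -> T (a ^+ k) = T a ^+ k.
Proof.
case=> _ T1 TM; elim: k => [|k IH]; first by rewrite !expr0.
by rewrite !exprS TM IH.
Qed.

Lemma cmorph_prod m n (T : ncps K m -> ncps K n) I (r : seq I) (P : pred I)
    (f : I -> ncps K m) : cmorph T ->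
  T (\prod_(i <- r | P i) f i) = \prod_(i <- r | P i) T (f i).
Proof. by case=> _ T1 TM; apply: (big_morph T TM T1). Qed.

Lemma cmorph_comp l m n (S : ncps K m -> ncps K n) (T : ncps K l -> ncps K m) :
  cmorph S -> cmorph T -> cmorph (fun a => S (T a)).
Proof.
case=> cS S1 SM [cT T1 TM]; split; first exact: clinear_comp.
  by rewrite T1.
by move=> a b; rewrite TM SM.
Qed.

Lemma cmorph_id n : cmorph (fun a : ncps K n => a). Proof. by []. Qed.

Lemma cmorph_ext m n (S T : ncps K m -> ncps K n) : cmorph S -> cmorph T ->
  (forall i, S (ncX K i) = T (ncX K i)) -> S =1 T.
Proof.
move=> aS aT ST; have [cS _ _] := aS; have [cT _ _] := aT.
apply: clinear_ext => // v; rewrite /mono !cmorph_prod //.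
by apply: eq_bigr => i _.
Qed.

Lemma cmorph_brk m n (T : ncps K m -> ncps K n) a b : cmorph T ->
  T (brk a b) = brk (T a) (T b).
Proof. by case=> cT _ TM; rewrite /brk clinearB // !TM. Qed.

Lemma cmorph_nil m n (T : ncps K m -> ncps K n) (a : ncps K m) :
  cmorph T -> T a [::] = a [::].
Proof.
case=> cT T1 TM; have : agree 0 a (a [::] *: 1).
  by case=> // _; rewrite nc_scaleE nc_oneE mulr1.
by move/(clinear_agree cT)/(_ [::] isT)->; rewrite clinearZ // T1 nc_scaleE nc_oneE mulr1.
Qed.

Section Subst.
Variables (m n : nat) (f : 'I_m -> ncps K n).
Hypothesis f0 : forall i, f i [::] = 0.

Lemma prod_vanish v : vanish (size v) (\prod_(i <- v) f i).
Proof.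
elim: v => // i v IH; rewrite big_cons; apply: (@vanishM _ _ 1) => //.
exact/vanish1P.
Qed.

Lemma subst_mono v : subst f (mono K v) = \prod_(i <- v) f i.
Proof. by apply: clin_word => x; apply: prod_vanish. Qed.

Lemma subst_cmorph : cmorph (subst f).
Proof.
have cs : clinear (subst f) by apply: clinear_clin.
split=> //; first by have := subst_mono [::]; rewrite /mono !big_nil.
move=> a b; move: a; apply: clinear_ext => [||v].
- by apply: clinear_comp => //; apply: clinear_mulr.
- by apply: clinear_mulr.
move: b; apply: clinear_ext => [||v'].
- by apply: clinear_comp => //; apply: clinear_mull.
- by apply: clinear_mull.
by rewrite -mono_cat !subst_mono big_cat.
Qed.

Lemma substX i : subst f (ncX K i) = f i.
Proof. by have := subst_mono [:: i]; rewrite /mono !big_seq1. Qed.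
End Subst.

(** * Power series in one variable *)

Lemma ps_agree n (h : nat -> K) (a : ncps K n) N : a [::] = 0 ->
  agree N (ps h a) (\sum_(k < N.+1) h k *: a ^+ k).
Proof.
move=> /vanish1P a0; apply: (csum_agree (f := fun k => h k *: a ^+ k)) => k.
by apply: vanishZ; apply: vanishX.
Qed.

Lemma cmorph_ps m n (T : ncps K m -> ncps K n) h (a : ncps K m) :
  cmorph T -> a [::] = 0 ->
  T (ps h a) = ps h (T a).
Proof.
move=> aT a0; have [cT _ _] := aT; apply: agree_eq => N.
apply: agree_trans (clinear_agree cT (ps_agree h a0 (N := N))) _.
apply: agree_sym; apply: agree_trans (ps_agree h _ (N := N)) _.
  by rewrite cmorph_nil.
rewrite clinear_sum //; apply: agree_sum => k _.
by rewrite clinearZ // (cmorphX _ _ aT).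
Qed.

Lemma cmorph_nexp m n (T : ncps K m -> ncps K n) (a : ncps K m) :
  cmorph T -> a [::] = 0 ->
  T (nexp a) = nexp (T a).
Proof. exact: cmorph_ps. Qed.

Lemma nexp_nil n (a : ncps K n) : nexp a [::] = 1.
Proof. by rewrite /nexp /ps big_ord1 /= invr1 mul1r expr0. Qed.

Lemma nexp0 n : nexp (0 : ncps K n) = 1.
Proof.
apply/funext => w; rewrite /nexp /ps big_ord_recl expr0 invr1 mul1r big1 ?addr0 // => k _.
by rewrite lift0 expr0n mulr0.
Qed.

Lemma nlog_nil n (a : ncps K n) : nlog a [::] = 0.
Proof. by rewrite /nlog /ps big_ord1 /= invr0 mulr0 mul0r. Qed.

Lemma ninv_nil n (a : ncps K n) : ninv a [::] = 1.
Proof. by rewrite /ninv /ps big_ord1 /= mul1r expr0. Qed.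

Lemma mulVnc n (a : ncps K n) : a [::] = 1 -> ninv a * a = 1.
Proof. exact: ninvM. Qed.

Lemma mulncV n (a : ncps K n) : a [::] = 1 -> a * ninv a = 1.
Proof.
move=> a1; have b1 : ninv a * a = 1 by apply: mulVnc.
have c1 : ninv (ninv a) * ninv a = 1 by rewrite mulVnc ?ninv_nil.
by rewrite -[LHS]mul1r -{1}c1 -mulrA (mulrA _ a) b1 mul1r.
Qed.

Lemma nc_mulKl n (g a : ncps K n) : g [::] = 1 -> ninv g * (g * a) = a.
Proof. by move=> g1; rewrite mulrA mulVnc // mul1r. Qed.

Lemma nc_mulIl n (g a b : ncps K n) : g [::] = 1 -> g * a = g * b -> a = b.
Proof. by move=> g1 ab; rewrite -(nc_mulKl a g1) ab nc_mulKl. Qed.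

Definition conjnc n (g a : ncps K n) := ninv g * a * g.

Lemma conjnc_cmorph n (g : ncps K n) : g [::] = 1 -> cmorph (conjnc g).
Proof.
move=> g1; split; first exact/clinear_mulr/clinear_mull.
  by rewrite /conjnc mulr1 mulVnc.
move=> a b; rewrite /conjnc -!mulrA; do 2![congr (_ * _)].
by rewrite [RHS]mulrA mulncV // mul1r.
Qed.

Lemma act_cmorph n (F : 'I_n -> ncps K n) : cmorph (act F).
Proof. by apply: subst_cmorph => i; rewrite !nc_mul0E mulr0 mul0r. Qed.

Lemma actX n (F : 'I_n -> ncps K n) i : act F (ncX K i) = conjnc (F i) (ncX K i).
Proof. by rewrite /act substX // => k; rewrite !nc_mul0E mulr0 mul0r. Qed.

End Clinear.

Section Csum.
Variables (K : fieldType) (n : nat).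
Local Notation A := (ncps K n).
Implicit Types (f g : nat -> A) (a b : A).

Lemma clinear_csum m (T : A -> ncps K m) f : clinear T ->
  (forall k, vanish k (f k)) ->
  T (csum f) = fun w => \sum_(k < (size w).+1) T (f k) w.
Proof.
move=> cT fv; apply/funext => w.
rewrite (clinear_agree cT (csum_agree (N := size w) fv)) //.
by rewrite clinear_sum // nc_sumE.
Qed.

Lemma opexp_csum (M : A -> A) t a :
  opexp M t a = csum (fun k => (t ^+ k / k`!%:R) *: iter k M a).
Proof. by []. Qed.

(** * Lie elements *)

Lemma Lie_poly_Lie a : lie_poly a -> Lie a.
Proof. by move=> la N; exists a. Qed.

Lemma Lie_closed a : (forall N, exists2 p, Lie p & agree N a p) -> Lie a.
Proof.
move=> H N; have [p lp ap] := H N; have [q lq pq] := lp N.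
by exists q => //; exact: agree_trans ap pq.
Qed.

Lemma Lie0 : Lie (0 : A). Proof. exact/Lie_poly_Lie/lie_poly0. Qed.
Lemma LieX i : Lie (ncX K i : A). Proof. exact/Lie_poly_Lie/lie_polyX. Qed.

Lemma LieZD k a b : Lie a -> Lie b -> Lie (k *: a + b).
Proof.
move=> la lb N; have [p lp ap] := la N; have [q lq bq] := lb N.
exists (k *: p + q); first exact: lie_polyZD.
by apply: agreeD => //; apply: agreeZ.
Qed.
Lemma LieD a b : Lie a -> Lie b -> Lie (a + b).
Proof. by move=> la lb; rewrite -[a]scale1r; apply: LieZD. Qed.
Lemma LieZ k a : Lie a -> Lie (k *: a).
Proof. by move=> la; rewrite -[_ *: _]addr0; apply: LieZD => //; apply: Lie0. Qed.
Lemma LieN a : Lie a -> Lie (- a).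
Proof. by move=> la; rewrite -scaleN1r; apply: LieZ. Qed.
Lemma Lie_brk a b : Lie a -> Lie b -> Lie (brk a b).
Proof.
move=> la lb N; have [p lp ap] := la N; have [q lq bq] := lb N.
by exists (brk p q); [apply: lie_poly_brk|apply: agree_brk].
Qed.
Lemma Lie_sum I (r : seq I) (P : pred I) (f : I -> A) :
  (forall i, P i -> Lie (f i)) -> Lie (\sum_(i <- r | P i) f i).
Proof.
move=> lf; apply: (big_ind (fun a => Lie a)) => //; first exact: Lie0.
exact: LieD.
Qed.

Lemma Lie_csum f : (forall k, vanish k (f k)) -> (forall k, Lie (f k)) ->
  Lie (csum f).
Proof.
move=> fv lf; apply: Lie_closed => N; exists (\sum_(k < N.+1) f k).
  by apply: Lie_sum => k _.
exact: csum_agree.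
Qed.

End Csum.

Lemma Lie_map (K : fieldType) m n (T : ncps K n -> ncps K m) : clinear T ->
  (forall p, lie_poly p -> Lie (T p)) -> forall a, Lie a -> Lie (T a).
Proof.
move=> cT lT a la; apply: Lie_closed => N; have [p lp ap] := la N.
by exists (T p); [apply: lT|apply: clinear_agree].
Qed.

Lemma Lie_cmorph (K : fieldType) m n (T : ncps K n -> ncps K m) : cmorph T ->
  (forall i, Lie (T (ncX K i))) -> forall a, Lie a -> Lie (T a).
Proof.
move=> aT TX; have [cT _ _] := aT; apply: Lie_map => // p.
elim=> [||k a b _ la _ lb|a b _ la _ lb] //.
- by rewrite (clinear0 cT); apply: Lie0.
- by rewrite cT.1; apply: LieZD.
- by rewrite (cmorph_brk _ _ aT); apply: Lie_brk.
Qed.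

Section Euler.
Variables (K : fieldType) (n : nat).
Local Notation A := (ncps K n).
Implicit Types (f g : nat -> A) (a b : A).

Definition derivation (D : A -> A) := forall a b, D (a * b) = D a * b + a * D b.

Lemma derivation_brk D a b : clinear D -> derivation D ->
  D (brk a b) = brk (D a) b + brk a (D b).
Proof.
move=> cD dD; rewrite /brk (clinearB cD) !dD opprD addrACA.
by rewrite addrACA [- (D b * a) - _]addrC addrACA.
Qed.

Lemma Lie_derivation D : clinear D -> derivation D ->
  (forall i, Lie (D (ncX K i))) -> forall a, Lie a -> Lie (D a).
Proof.
move=> cD dD DX a; apply: Lie_map => // {a} p.
elim=> [||k a b _ la _ lb|a b lpa la lpb lb] //.
- by rewrite (clinear0 cD); apply: Lie0.
- by rewrite cD.1; apply: LieZD.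
- rewrite derivation_brk //; apply: LieD; apply: Lie_brk => //;
  exact: Lie_poly_Lie.
Qed.

(** * The Euler derivation *)

Definition euler a : A := fun w => (size w)%:R * a w.

Lemma eulerE a w : euler a w = (size w)%:R * a w. Proof. by []. Qed.

Lemma clinear_euler : clinear euler.
Proof.
split=> [k a b|N a b ab w wN]; last by rewrite !eulerE ab.
by apply/funext => w; rewrite !(eulerE, nc_addE, nc_scaleE) mulrDr mulrCA.
Qed.

Lemma derivation_euler : derivation euler.
Proof.
move=> a b; apply/funext => w; rewrite eulerE nc_addE !nc_mulE mulr_sumr -big_split.
apply: eq_bigr => k _; rewrite !eulerE /= -mulrA (mulrCA (a _)) -mulrDl -natrD.
by rewrite -size_cat cat_take_drop.
Qed.

Lemma eulerX i : euler (ncX K i) = ncX K i.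
Proof.
apply/funext => w; rewrite eulerE /ncX.
by case: eqP => [->|]; rewrite ?mul1r ?mulr0.
Qed.

Lemma euler1 : euler 1 = 0.
Proof.
by apply/funext => w; rewrite eulerE nc_oneE; case: eqP => [->|]; rewrite ?mul0r ?mulr0.
Qed.

Lemma euler_nil a : euler a [::] = 0.
Proof. by rewrite eulerE mul0r. Qed.

Lemma Lie_euler a : Lie a -> Lie (euler a).
Proof.
apply: Lie_derivation clinear_euler derivation_euler _ _ => i.
by rewrite eulerX; apply: LieX.
Qed.

Hypothesis charK : [pchar K] =i pred0.

Lemma natr_neq0 k : k.+1%:R != 0 :> K.
Proof. by rewrite ((pcharf0P K).1 charK). Qed.

Lemma euler_inj a b : a [::] = b [::] -> euler a = euler b -> a = b.
Proof.
move=> ab E; apply/funext => -[//|i w]; apply: (mulfI (natr_neq0 (size w))).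
by have /(congr1 (fun c : A => c (i :: w))) := E.
Qed.

Definition hcomp (N : nat) a : A := fun w => if size w == N then a w else 0.

Lemma clinear_hcomp N : clinear (hcomp N).
Proof.
split=> [k a b|M a b ab w wM]; last by rewrite /hcomp; case: eqP; rewrite // ab.
apply/funext => w; rewrite nc_addE nc_scaleE /hcomp.
by case: eqP; rewrite // mulr0 addr0.
Qed.

Lemma hcompM N a b :
  hcomp N (a * b) = \sum_(i < N.+1) hcomp i a * hcomp (N - i)%N b.
Proof.
apply/funext => w; rewrite nc_sumE /hcomp.
under [RHS]eq_bigr do rewrite nc_mulE.
have sd k : size (drop k w) = (size w - k)%N := size_drop k w.
case: eqP => [wN|wN].
  rewrite -wN nc_mulE; apply: eq_bigr => k _.
  have kw : (k <= size w)%N by rewrite -ltnS.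
  rewrite (bigD1 k) //= size_takel // sd !eqxx big1 ?addr0 // => l lk.
  rewrite size_takel; last by rewrite -ltnS.
  by case: eqP => [kl|]; rewrite ?mul0r //; case/eqP: lk; apply: val_inj.
rewrite big1 // => i _; rewrite big1 // => k _.
have kw : (k <= size w)%N by rewrite -ltnS.
have iN : (i <= N)%N by rewrite -ltnS.
case: eqP => [ti|]; last by rewrite mul0r.
case: eqP => [di|]; last by rewrite mulr0.
by case: wN; rewrite -(cat_take_drop k w) size_cat ti di subnKC.
Qed.

Lemma hcomp_brk N a b :
  hcomp N (brk a b) = \sum_(i < N.+1) brk (hcomp i a) (hcomp (N - i)%N b).
Proof.
rewrite /brk (clinearB (clinear_hcomp N)) !hcompM sumrB; congr (_ - _).
rewrite (reindex_inj rev_ord_inj); apply: eq_bigr => i _ /=.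
by rewrite subSS subKn // -ltnS.
Qed.

Lemma lie_poly_sum I (r : seq I) (P : pred I) (f : I -> A) :
  (forall i, P i -> lie_poly (f i)) -> lie_poly (\sum_(i <- r | P i) f i).
Proof.
move=> lf; apply: (big_ind (fun a => lie_poly a)) => //; first exact: lie_poly0.
by move=> a b la lb; rewrite -[a]scale1r; apply: lie_polyZD.
Qed.

Lemma lie_poly_hcomp N a : lie_poly a -> lie_poly (hcomp N a).
Proof.
move=> la; elim: la N => {a} [|i|k a b _ la _ lb|a b _ la _ lb] N.
- by rewrite (clinear0 (clinear_hcomp N)); apply: lie_poly0.
- have [->|N1] := eqVneq N 1%N.
    rewrite (_ : hcomp 1 _ = ncX K i); first exact: lie_polyX.
    apply/funext => w; rewrite /hcomp /ncX; case: eqP => // w1.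
    by case: eqP => // wi; rewrite wi in w1.
  rewrite (_ : hcomp N _ = 0); first exact: lie_poly0.
  apply/funext => w; rewrite /hcomp /ncX; case: eqP => // wN.
  by case: eqP => // wi; rewrite wi /= in wN; rewrite -wN in N1.
- by rewrite (clinear_hcomp N).1; apply: lie_polyZD.
- by rewrite hcomp_brk; apply: lie_poly_sum => i _; apply: lie_poly_brk.
Qed.

Lemma hcomp_agree N a b : agree N a b -> hcomp N a = hcomp N b.
Proof.
by move=> ab; apply/funext => w; rewrite /hcomp; case: eqP => // wN; rewrite ab ?wN.
Qed.

Lemma Lie_hcomp N a : Lie a -> lie_poly (hcomp N a).
Proof. by case/(_ N) => p lp /hcomp_agree ->; apply: lie_poly_hcomp. Qed.

Lemma agree_hcomp N a p : agree N a p ->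
  agree N.+1 a (\sum_(i < N.+1) hcomp i p + hcomp N.+1 a).
Proof.
move=> ap w; rewrite leq_eqVlt nc_addE nc_sumE /hcomp => /orP[/eqP wN|wN].
  rewrite wN eqxx big1 ?add0r // => i _.
  by rewrite [_ == _]gtn_eqF.
rewrite ltn_eqF // addr0 (bigD1 (Ordinal wN)) //= eqxx big1 ?addr0; first exact: ap.
move=> i iw; case: eqP => // wi; case/eqP: iw; exact: val_inj.
Qed.

(** * Commuting the Euler derivation with an exponential *)

Section EulerExp.
Variables (M : A -> A) (Y : nat -> A -> A).
Hypotheses (cM : clinear M) (rM : raises 1 M).
Hypothesis Y0 : forall a, Y 0 a = euler (M a) - M (euler a).
Hypothesis YS : forall k a, Y k.+1 a = Y k (M a) - M (Y k a).

Lemma euler_iter k a : euler (iter k M a) =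
  iter k M (euler a) +
  \sum_(j < k) 'C(k, j.+1)%:R *: iter (k.-1 - j)%N M (Y j a).
Proof.
elim: k a => [|k IH] a; first by rewrite big_ord0 addr0.
have lI q : lin (iter q M) by apply: lin_iter cM.1.
rewrite iterSr IH.
have -> : euler (M a) = M (euler a) + Y 0 a by rewrite Y0 addrC subrK.
rewrite (linD _ _ (lI k)) -iterSr -addrA; congr (_ + _).
have H (j : 'I_k) : 'C(k, j.+1)%:R *: iter (k.-1 - j)%N M (Y j (M a)) =
    'C(k, j.+1)%:R *: iter (k - j)%N M (Y j a) +
    'C(k, j.+1)%:R *: iter (k.-1 - j)%N M (Y j.+1 a).
  have -> : Y j (M a) = M (Y j a) + Y j.+1 a by rewrite YS addrC subrK.
  rewrite (linD _ _ (lI _)) scalerDr -iterSr; congr (_ *: iter _ M _ + _).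
  by case: k j {IH} => [[]|k j] //=; rewrite subSn // -ltnS.
under eq_bigr do rewrite H.
rewrite big_split /= addrCA.
under [RHS]eq_bigr => j _ do rewrite binS natrD scalerDl.
rewrite [RHS]big_split /=; congr (_ + _).
  by rewrite big_ord_recr /= bin_small // scale0r addr0.
rewrite big_ord_recl bin0 scale1r subn0; congr (_ + _); apply: eq_bigr => j _.
rewrite lift0; congr (_ *: iter _ M _).
by case: k j {IH H} => [[]|k j].
Qed.

Lemma Y_raises k : raises k.+1 (Y k).
Proof.
elim: k => [|k IH] d a da.
  rewrite Y0; apply: vanishD; first exact/(clinear_vanish clinear_euler)/rM.
  by apply: vanishN; apply: rM; apply: clinear_vanish clinear_euler _ _ _.
rewrite YS; apply: vanishD; first by rewrite addSnnS; apply: IH; apply: rM.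
by apply: vanishN; rewrite addSn -add1n; apply: rM; apply: IH.
Qed.

Lemma Yk_vanish k a : vanish k.+1 (Y k a).
Proof. by have := @Y_raises k 0 a; rewrite addn0; apply. Qed.

Lemma euler_opexp a :
  euler (opexp M 1 a) =
  opexp M 1 (euler a + csum (fun k => k.+1`!%:R^-1 *: Y k a)).
Proof.
have opA c N : agree N (opexp M 1 c) (\sum_(k < N.+1) k`!%:R^-1 *: iter k M c).
  apply: agree_trans (opexpE 1 _ rM) _ => //.
  by apply: agree_sum => k _; rewrite expr1n mul1r.
set S := csum _.
have SA N : agree N S (\sum_(j < N.+1) j.+1`!%:R^-1 *: Y j a).
  apply: csum_agree => j; apply: vanishZ; exact: (vanishW (leqnSn _) (@Yk_vanish j a)).
rewrite (linD _ _ (opexp_lin 1 cM.1)); apply: agree_eq => N.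
apply: agree_trans (clinear_agree clinear_euler (opA _ _)) _.
apply: agree_sym; apply: agree_trans (agreeD (opA _ _) (opA _ _)) _.
rewrite (clinear_sum clinear_euler).
under [X in agree _ _ X]eq_bigr => k _ do
  rewrite (clinearZ clinear_euler) euler_iter scalerDr.
rewrite -/(agree N _ _) big_split /=; apply: agreeD => //.
have cI q : clinear (iter q M).
  by elim: q => // q IH; apply: (clinear_comp cM IH).
have step : agree N (\sum_(k < N.+1) k`!%:R^-1 *: iter k M S)
    (\sum_(k < N.+1) k`!%:R^-1 *:
       iter k M (\sum_(j < N.+1) j.+1`!%:R^-1 *: Y j a)).
  by apply: agree_sum => k _; apply: agreeZ; apply: clinear_agree.
apply: (agree_trans step) => {step}.
move=> w wN; rewrite !nc_sumE.
pose c (l j : nat) := l`!%:R^-1 * (j.+1`!%:R^-1 * iter l M (Y j a) w).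
have c0 l j : (N <= l + j)%N -> c l j = 0.
  move=> Nlj; rewrite /c; have := @raises_iter K n M l rM _ _ (@Yk_vanish j a).
  by move->; rewrite ?mulr0 // (leq_ltn_trans wN) // addnS ltnS.
transitivity (\sum_(l < N.+1) \sum_(j < N.+1) c l j).
  apply: eq_bigr => l _; rewrite nc_scaleE clinear_sum // nc_sumE mulr_sumr.
  by apply: eq_bigr => j _; rewrite clinearZ // nc_scaleE.
rewrite sum_triangle; last by move=> l j /ltnW; apply: c0.
rewrite big_ord_recr /= [X in _ + X]big1 ?addr0; last first.
  by move=> l _; apply: c0; rewrite subnKC // -ltnS.
rewrite big_ord_recl big_ord0 scaler0 add0r; apply: eq_bigr => m _.
rewrite lift0 (reindex_inj rev_ord_inj) nc_scaleE nc_sumE mulr_sumr /=.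
apply: eq_bigr => j _; have jm : (j <= m)%N by rewrite -ltnS.
rewrite subSS subKn // /c nc_scaleE !mulrA; congr (_ * _).
have := inv_bin_fact charK (lift ord0 j : 'I_m.+2).
by rewrite lift0 subSS [RHS]mulrC => <-; rewrite mulrC.
Qed.
End EulerExp.

End Euler.

Section Exponential.
Variables (K : fieldType) (n : nat).
Local Notation A := (ncps K n).
Implicit Types (a b c g l : A).

Lemma iter_mull l k c : iter k (fun a => l * a) c = l ^+ k * c.
Proof. by elim: k => [|k IH]; rewrite ?mul1r // iterS IH mulrA -exprS. Qed.

Lemma iter_mulr l k c : iter k (fun a => a * l) c = c * l ^+ k.
Proof. by elim: k => [|k IH]; rewrite ?mulr1 // iterS IH -mulrA -exprSr. Qed.

Lemma nexp_csum l : nexp l = csum (fun k => k`!%:R^-1 *: l ^+ k).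
Proof. by []. Qed.

Lemma opexp_mull l c : l [::] = 0 -> opexp (fun a => l * a) 1 c = nexp l * c.
Proof.
move=> l0; rewrite nexp_csum (clinear_csum (T := fun a => a * c)).
- apply/funext => w; apply: eq_bigr => k _.
  by rewrite expr1n mul1r iter_mull -nc_scaleE scalerAl.
- exact: clinear_mulr _ (clinear_id _ _).
- by move=> k; apply: vanishZ; apply: vanishX; apply/vanish1P.
Qed.

Lemma opexp_mulr1 l : opexp (fun a => a * l) 1 1 = nexp l.
Proof.
apply/funext => w; apply: eq_bigr => k _.
by rewrite expr1n mul1r iter_mulr mul1r.
Qed.

Lemma raises_mul_l l : l [::] = 0 -> raises 1 (fun a => l * a).
Proof. by move=> l0 d a da; apply: vanishM => //; apply/vanish1P. Qed.

Lemma raises_mul_r l : l [::] = 0 -> raises 1 (fun a => a * l).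
Proof. by move=> l0 d a da; rewrite addnC; apply: vanishM => //; apply/vanish1P. Qed.

Lemma clinear_brkr l : clinear (fun a => brk a l).
Proof.
apply: clinear_add; first exact: clinear_mulr _ (clinear_id _ _).
exact: clinear_opp (clinear_mull _ (clinear_id _ _)).
Qed.

Lemma raises_brkr l : l [::] = 0 -> raises 1 (fun a => brk a l).
Proof.
by move=> l0 d a da; rewrite addnC; apply: vanish_brk => //; apply/vanish1P.
Qed.

(** [(- ad a)^j (euler a)] *)
Fixpoint ad_euler a j : A := if j is j'.+1 then brk (ad_euler a j') a else euler a.

Definition logder a : A := csum (fun j => j.+1`!%:R^-1 *: ad_euler a j).

Lemma ad_euler_vanish a j : a [::] = 0 -> vanish j.+1 (ad_euler a j).
Proof.
move=> a0; elim: j => [|j IH]; first exact/vanish1P/euler_nil.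
by rewrite -addn1; apply: vanish_brk => //; apply/vanish1P.
Qed.

Lemma logder_vanish a k : a [::] = 0 -> vanish k (k.+1`!%:R^-1 *: ad_euler a k).
Proof.
by move=> a0; apply: vanishZ; apply: (vanishW (leqnSn _)); apply: ad_euler_vanish.
Qed.

Lemma Lie_adY a j : Lie a -> Lie (ad_euler a j).
Proof.
by move=> la; elim: j => [|j IH]; [apply: Lie_euler|apply: Lie_brk].
Qed.

Lemma Lie_logder a : Lie a -> Lie (logder a).
Proof.
move=> la; apply: Lie_csum => k; first by apply/logder_vanish/lie_nil.
by apply/LieZ/Lie_adY.
Qed.

Hypothesis charK : [pchar K] =i pred0.

Lemma euler_nexp a : a [::] = 0 -> euler (nexp a) = nexp a * logder a.
Proof.
move=> a0; rewrite -[nexp a]mulr1 -opexp_mull //.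
rewrite (euler_opexp charK (Y := fun j c => ad_euler a j * c)) //.
- rewrite euler1 add0r opexp_mull // opexp_mull // mulr1; congr (_ * _).
  by apply/funext => w; apply: eq_bigr => j _; rewrite mulr1.
- exact: clinear_mull _ (clinear_id _ _).
- exact: raises_mul_l.
- by move=> c; rewrite derivation_euler addrK.
- by move=> k c; rewrite /= /brk mulrBl !mulrA.
Qed.

Lemma agree_brkS N a a' b b' :
  vanish 1 a' -> vanish 1 b -> agree N a a' -> agree N b b' ->
  vanish 1 a -> vanish 1 b' ->
  agree N.+1 (brk a b) (brk a' b').
Proof.
move=> a'0 b0 /agreeB aa /agreeB bb a0 b'0.
have M (x x' y y' : A) : vanish 1 x' -> vanish 1 y -> vanish N.+1 (x - x') ->
    vanish N.+1 (y - y') -> agree N.+1 (x * y) (x' * y').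
  move=> x0 y0 xx yy; apply/agreeB.
  have -> : x * y - x' * y' = (x - x') * y + x' * (y - y').
    by rewrite mulrBl mulrBr addrA subrK.
  apply: vanishD; first by rewrite -addn1; apply: vanishM.
  by rewrite -add1n; apply: vanishM.
by apply: agreeD; [|apply: agreeN]; apply: M.
Qed.

Lemma hcomp_euler N a : hcomp N (euler a) = N%:R *: hcomp N a.
Proof.
apply/funext => w; rewrite nc_scaleE /hcomp.
by case: eqP => [<-|]; rewrite ?mulr0 ?eulerE.
Qed.

(* In degree [N+1] the terms [j > 0] of [logder a] only involve the components
   of [a] of degree at most [N], so that [euler a] is determined up to Lie
   polynomials by [logder a]. *)
Lemma logder_Lie a : a [::] = 0 -> Lie (logder a) -> Lie a.
Proof.
move=> a0 lB; elim=> [|N [p lp ap]].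
  by exists 0; [apply: lie_poly0|case].
exists (\sum_(i < N.+1) hcomp i p + hcomp N.+1 a); last exact: agree_hcomp.
rewrite -[\sum_(_ < _) _]scale1r; apply: lie_polyZD.
  by apply: lie_poly_sum => i _; apply: lie_poly_hcomp.
have p0 : p [::] = 0 by rewrite -ap.
have aY j : agree N (ad_euler a j) (ad_euler p j).
  elim: j => [|j IH]; first exact: clinear_agree (clinear_euler _ _) _ _ _ ap.
  exact: agree_brk.
have aYS j : agree N.+1 (ad_euler a j.+1) (ad_euler p j.+1).
  by apply: agree_brkS => //; try exact/vanish1P;
    apply: (vanishW (ltn0Sn j)); apply: ad_euler_vanish.
set S := \sum_(j < N.+1) j.+2`!%:R^-1 *: ad_euler p j.+1.
have aB : agree N.+1 (logder a) (euler a + S).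
  apply: agree_trans (csum_agree (fun k => logder_vanish a0 (k := k))) _.
  rewrite big_ord_recl /= invr1 scale1r; apply: agreeD => //.
  by apply: agree_sum => j _; apply: agreeZ; apply: aYS.
have eB : hcomp N.+1 (euler a) = hcomp N.+1 (logder a) - hcomp N.+1 S.
  by rewrite (hcomp_agree aB) (clinearD (clinear_hcomp _ _ _)) addrK.
have -> : hcomp N.+1 a = N.+1%:R^-1 *: hcomp N.+1 (euler a) + 0.
  by rewrite addr0 hcomp_euler scalerA mulVf ?scale1r // natr_neq0.
apply: lie_polyZD; last exact: lie_poly0.
rewrite eB addrC -scaleN1r; apply: lie_polyZD; last exact: Lie_hcomp.
apply: Lie_hcomp; apply: Lie_sum => j _; apply: LieZ; apply: Lie_adY.
exact: Lie_poly_Lie.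
Qed.

Lemma mul_nexp l c : l [::] = 0 ->
  c * nexp l = nexp l * opexp (fun a => brk a l) 1 c.
Proof.
move=> l0; rewrite -opexp_mulr1.
rewrite -(opexpM charK (R := fun a => brk a l)).
- rewrite mul1r (opexp_csum _ _ c) opexp_csum.
  rewrite (clinear_csum (T := fun a => c * a)).
  + apply/funext => w; apply: eq_bigr => k _.
    by rewrite !iter_mulr mul1r scalerAr.
  + exact: clinear_mull _ (clinear_id _ _).
  + move=> k; apply: vanishZ; rewrite iter_mulr mul1r; apply: vanishX.
    exact/vanish1P.
- exact: (clinear_mulr _ (clinear_id _ _)).1.
- exact: raises_mul_r.
- exact: (clinear_brkr _).1.
- exact: raises_brkr.
- by move=> a b; rewrite /brk mulrBr !mulrA addrC subrK.
Qed.

Lemma conj_nexp l c : l [::] = 0 ->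
  conjnc (nexp l) c = opexp (fun a => brk a l) 1 c.
Proof.
by move=> l0; rewrite /conjnc -mulrA mul_nexp // nc_mulKl // nexp_nil.
Qed.

Lemma Lie_opexp (M : A -> A) c : clinear M -> raises 1 M ->
  (forall a, Lie a -> Lie (M a)) -> Lie c -> Lie (opexp M 1 c).
Proof.
move=> cM rM lM lc; rewrite opexp_csum; apply: Lie_csum => k.
  by apply: vanishZ; apply: iter_vanish.
by apply: LieZ; elim: k => // k IH; apply: lM.
Qed.

Lemma Lie_conj l c : Lie l -> Lie c -> Lie (conjnc (nexp l) c).
Proof.
move=> ll lc; have l0 := lie_nil ll; rewrite conj_nexp //.
apply: Lie_opexp => //; [exact: clinear_brkr|exact: raises_brkr|].
by move=> a la; apply: Lie_brk.
Qed.

End Exponential.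

Section ExpLogOne.
Variable K : fieldType.
Hypothesis charK : [pchar K] =i pred0.
Implicit Types a b g : ncps K 1.

Lemma ncps1_mulC a b : a * b = b * a.
Proof.
have E (v w : seq 'I_1) : size v = size w -> v = w.
  by move=> vw; apply: (eq_from_nth (x0 := ord0)) => // i _; rewrite ord1 [RHS]ord1.
apply/funext => w; rewrite !nc_mulE (reindex_inj rev_ord_inj) /=.
apply: eq_bigr => k _; have kw : (k <= size w)%N by rewrite -ltnS.
rewrite mulrC subSS; congr (b _ * a _); apply: E.
  by rewrite size_drop subKn // size_takel.
by rewrite size_drop size_takel // leq_subr.
Qed.

Lemma euler_nexp1 a : a [::] = 0 -> euler (nexp a) = nexp a * euler a.
Proof.
move=> a0; rewrite euler_nexp //; congr (_ * _).
apply/funext => w; rewrite /logder /csum big_ord_recl /= invr1 nc_scaleE mul1r.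
by rewrite big1 ?addr0 // => k _; rewrite /= /brk ncps1_mulC subrr scaler0.
Qed.

Lemma euler_expr1 a k : euler (a ^+ k.+1) = k.+1%:R *: (a ^+ k * euler a).
Proof.
elim: k => [|k IH]; first by rewrite expr1 mul1r scale1r.
rewrite exprS derivation_euler IH -scalerAr mulrA -exprS ncps1_mulC.
by rewrite -[k.+2]add1n natrD scalerDl scale1r.
Qed.

Lemma euler_nlog1 g : g [::] = 1 -> euler (nlog g) = ninv g * euler g.
Proof.
move=> g1; set a := g - 1.
have a0 : a [::] = 0 by rewrite /a nc_addE nc_oppE g1 subrr.
have -> : euler g = euler a by rewrite (clinearB (clinear_euler _ _)) euler1 subr0.
apply: agree_eq => N; pose c k : K := (-1) ^+ k.+1 / k%:R.
have := clinear_agree (clinear_euler _ _) (ps_agree c a0 (N := N.+1)).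
move=> /(agreeW (leqnSn N)) H; apply: (agree_trans H) => {H}.
have b0 : (1 - g) [::] = 0 by rewrite nc_addE nc_oppE g1 subrr.
apply: agree_sym.
apply: agree_trans (agreeM (ps_agree (fun=> 1) b0) (agree_refl (euler a))) _.
rewrite (clinear_sum (clinear_euler _ _)) [\sum_(_ < N.+2) _]big_ord_recl expr0.
rewrite (clinearZ (clinear_euler _ _)) euler1 scaler0 add0r mulr_suml.
apply: agree_sum => k _; rewrite (clinearZ (clinear_euler _ _)) euler_expr1 scalerA.
rewrite /c -mulrA mulVf ?natr_neq0 // mulr1 !exprS mulN1r mulN1r opprK scale1r.
by rewrite -opprB -[- a]scaleN1r exprZn scalerAl.
Qed.

Lemma euler_eq0 a : euler a = 0 -> a = a [::] *: 1.
Proof.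
move=> Ea; apply: (euler_inj charK).
  by rewrite nc_scaleE nc_oneE mulr1.
by rewrite Ea (clinearZ (clinear_euler _ _)) euler1 scaler0.
Qed.

Lemma nexp_nlog1 g : g [::] = 1 -> nexp (nlog g) = g.
Proof.
move=> g1; set f := nexp (nlog g).
have Ef : euler f = f * (ninv g * euler g).
  by rewrite euler_nexp1 ?nlog_nil // euler_nlog1.
pose q := f * ninv g.
have fq : f = q * g by rewrite -mulrA mulVnc // mulr1.
have Eq : euler q = 0.
  have := Ef; rewrite {1}fq derivation_euler mulrA -/q -[RHS]add0r => /addIr.
  by rewrite ncps1_mulC -[RHS](mulr0 g) => /(nc_mulIl g1).
have q1 : q [::] = 1 by rewrite /q nc_mul0E /f nexp_nil ninv_nil mulr1.
by rewrite fq (euler_eq0 Eq) q1 scale1r mul1r.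
Qed.

Lemma nlog_nexp1 a : a [::] = 0 -> nlog (nexp a) = a.
Proof.
move=> a0; apply: (euler_inj charK); first by rewrite nlog_nil a0.
by rewrite euler_nlog1 ?nexp_nil // euler_nexp1 // nc_mulKl // nexp_nil.
Qed.

End ExpLogOne.

Section GroupLike.
Variables (K : fieldType).
Hypothesis charK : [pchar K] =i pred0.

Lemma cmorph_nlog m n (T : ncps K m -> ncps K n) (g : ncps K m) : cmorph T ->
  g [::] = 1 -> T (nlog g) = nlog (T g).
Proof.
move=> aT g1; rewrite /nlog cmorph_ps ?nc_addE ?nc_oppE ?g1 ?subrr //.
by have [cT T1 _] := aT; rewrite (clinearB cT) T1.
Qed.

Lemma cmorph_ninv m n (T : ncps K m -> ncps K n) (g : ncps K m) : cmorph T ->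
  g [::] = 1 -> T (ninv g) = ninv (T g).
Proof.
move=> aT g1; have [_ T1 TM] := aT; have Tg : T g [::] = 1 by rewrite cmorph_nil.
by apply: (nc_mulIl Tg); rewrite -TM mulncV // T1 mulncV.
Qed.

Lemma cmorph_conj m n (T : ncps K m -> ncps K n) (g a : ncps K m) : cmorph T ->
  g [::] = 1 -> T (conjnc g a) = conjnc (T g) (T a).
Proof.
by move=> aT g1; have [_ _ TM] := aT; rewrite /conjnc !TM cmorph_ninv.
Qed.

Lemma nexp_nlog n (g : ncps K n) : g [::] = 1 -> nexp (nlog g) = g.
Proof.
move=> g1; pose z := ncX K (ord0 : 'I_1).
have s0 (i : 'I_1) : (g - 1) [::] = 0 by rewrite nc_addE nc_oppE g1 subrr.
have aT := subst_cmorph (f := fun=> g - 1) s0.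
have z1 : (1 + z) [::] = 1 by rewrite nc_addE nc_oneE addr0.
have Tz : subst (fun=> g - 1) (1 + z) = g.
  have [cT T1 _] := aT; rewrite (clinearD cT) T1 substX //.
  by rewrite addrC subrK.
by rewrite -{1}Tz -(cmorph_nlog aT) // -(cmorph_nexp aT) ?nlog_nil // nexp_nlog1.
Qed.

Lemma nlog_nexp n (a : ncps K n) : a [::] = 0 -> nlog (nexp a) = a.
Proof.
move=> a0; pose z := ncX K (ord0 : 'I_1).
have aT := subst_cmorph (f := fun=> a) (fun _ : 'I_1 => a0).
have Tz : subst (fun=> a) z = a by rewrite substX.
by rewrite -{1}Tz -(cmorph_nexp aT) // -(cmorph_nlog aT) ?nexp_nil // nlog_nexp1.
Qed.

Definition grouplike n (g : ncps K n) := exists2 l, Lie l & g = nexp l.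

Lemma grouplike_nil n (g : ncps K n) : grouplike g -> g [::] = 1.
Proof. by case=> l _ ->; rewrite nexp_nil. Qed.

Lemma grouplikeP n (g : ncps K n) : g [::] = 1 ->
  grouplike g <-> exists2 b, Lie b & euler g = g * b.
Proof.
move=> g1; split=> [[l ll ->]|[b lb Eg]].
  by exists (logder l); [apply: Lie_logder|rewrite euler_nexp // lie_nil].
exists (nlog g); last by rewrite nexp_nlog.
apply: (logder_Lie charK); first by rewrite nlog_nil.
suff -> : logder (nlog g) = b by [].
apply: (nc_mulIl g1); rewrite -Eg -{1}(nexp_nlog g1) -euler_nexp ?nlog_nil //.
by rewrite nexp_nlog.
Qed.

Lemma grouplike1 n : grouplike (1 : ncps K n).
Proof. by exists 0; [apply: Lie0|rewrite nexp0]. Qed.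

Lemma Lie_conj_grouplike n (g c : ncps K n) : grouplike g -> Lie c ->
  Lie (conjnc g c).
Proof. by case=> l ll -> lc; apply: Lie_conj. Qed.

Lemma grouplikeM n (g h : ncps K n) : grouplike g -> grouplike h ->
  grouplike (g * h).
Proof.
move=> gg gh; have g1 := grouplike_nil gg; have h1 := grouplike_nil gh.
apply/grouplikeP; first by rewrite nc_mul0E g1 h1 mulr1.
have [b lb Eg] := (grouplikeP g1).1 gg; have [c lc Eh] := (grouplikeP h1).1 gh.
exists (conjnc h b + c); first by apply: LieD => //; apply: Lie_conj_grouplike.
rewrite derivation_euler Eg Eh mulrDr !mulrA; congr (_ + _).
by rewrite /conjnc -!mulrA; congr (_ * _); rewrite [RHS]mulrA mulncV // mul1r.
Qed.

(** * The group TAut *)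

Section TAut.
Variable n : nat.
Local Notation A := (ncps K n).
Implicit Types (F G H : 'I_n -> A) (a b : A).

Lemma TAut_nil F i : TAut F -> F i [::] = 1.
Proof. by move=> /(_ i)/grouplike_nil. Qed.

Lemma Lie_act F a : TAut F -> Lie a -> Lie (act F a).
Proof.
move=> tF; apply: Lie_cmorph; first exact: act_cmorph.
by move=> i; rewrite actX; apply: Lie_conj_grouplike; [apply: tF|apply: LieX].
Qed.

Lemma act_nil F a : act F a [::] = a [::].
Proof. exact: cmorph_nil (act_cmorph F). Qed.

Lemma TAut_tcomp F G : TAut F -> TAut G -> TAut (tcomp F G).
Proof.
move=> tF tG i; apply: grouplikeM; first exact: tF.
have [l ll ->] := tG i; exists (act F l); first exact: Lie_act.
by rewrite (cmorph_nexp (act_cmorph F)) // lie_nil.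
Qed.

Lemma TAut_tid : TAut (@tid K n). Proof. by move=> i; apply: grouplike1. Qed.

Lemma act_tcomp F G a : (forall i, F i [::] = 1) -> (forall i, G i [::] = 1) ->
  act (tcomp F G) a = act F (act G a).
Proof.
move=> F1 G1; move: a; apply: cmorph_ext => [||i].
- exact: act_cmorph.
- by apply: cmorph_comp; exact: act_cmorph.
rewrite !actX (cmorph_conj _ (act_cmorph F)) // actX /tcomp /conjnc.
have FG : act F (G i) [::] = 1 by rewrite act_nil.
suff -> : ninv (F i * act F (G i)) = ninv (act F (G i)) * ninv (F i).
  by rewrite !mulrA.
have FG1 : (F i * act F (G i)) [::] = 1 by rewrite nc_mul0E F1 FG mulr1.
apply: (nc_mulIl FG1); rewrite mulncV // mulrA -[_ * _ * ninv (act _ _)]mulrA.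
by rewrite mulncV // mulr1 mulncV.
Qed.

Lemma act_tid a : act (@tid K n) a = a.
Proof.
move: a; apply: cmorph_ext => [||i]; first exact: act_cmorph.
- exact: cmorph_id.
rewrite actX /conjnc mulr1 -[RHS]mul1r; congr (_ * _).
by rewrite -[LHS]mulr1 mulVnc.
Qed.

Lemma tcompA F G H : (forall i, F i [::] = 1) -> (forall i, G i [::] = 1) ->
  tcomp F (tcomp G H) = tcomp (tcomp F G) H.
Proof.
move=> F1 G1; apply/funext => i; rewrite /tcomp -/(tcomp F G) act_tcomp //.
by have [_ _ aM] := act_cmorph F; rewrite aM mulrA.
Qed.

Lemma tcomp1 F : tcomp F (@tid K n) = F.
Proof.
by apply/funext => i; rewrite /tcomp; have [_ -> _] := act_cmorph F; rewrite mulr1.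
Qed.

Lemma tcomp1l F : tcomp (@tid K n) F = F.
Proof. by apply/funext => i; rewrite /tcomp act_tid mul1r. Qed.

Lemma tinv_eq F G : TAut F -> TAut G -> tcomp F G = @tid K n ->
  tcomp G F = @tid K n -> tinv F = G.
Proof.
move=> tF tG FG GF; rewrite /tinv; case: xgetP => [H _ [tH FH HF]|/(_ G) []]; last by [].
rewrite -[H]tcomp1 -FG tcompA => [|i|i]; [|exact: TAut_nil|exact: TAut_nil].
by rewrite HF tcomp1l.
Qed.

End TAut.
End GroupLike.

(** * Cyclic words *)

Section Cyclic.
Variables (K : fieldType) (n : nat).
Local Notation A := (ncps K n).
Implicit Types (a b c : A) (v w : seq 'I_n).

Lemma tocyc_eq0 a b : tocyc a = tocyc b <-> a - b \in @comm_closure K n.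
Proof.
by rewrite Quotient.idealrBE; split=> [ab|/eqP//]; apply/eqP.
Qed.

Lemma tocycD a b : tocyc (a + b) = tocyc a + tocyc b.
Proof. by rewrite /tocyc !piE. Qed.
Lemma tocyc0 : tocyc (0 : A) = 0.
Proof. by rewrite /tocyc !piE. Qed.
Lemma tocyc_sum I (r : seq I) (P : pred I) (f : I -> A) :
  tocyc (\sum_(i <- r | P i) f i) = \sum_(i <- r | P i) tocyc (f i).
Proof. by apply: (big_morph _ tocycD tocyc0). Qed.
Lemma tocyc_repr (q : cyc K n) : tocyc (repr q) = q.
Proof. exact: reprK. Qed.

Lemma comm_closureP a : reflect (forall N, exists s : seq (A * A),
    agree N a (\sum_(p <- s) brk p.1 p.2)) (a \in @comm_closure K n).
Proof. exact: asboolP. Qed.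

Lemma comm_closure_brk a b : brk a b \in @comm_closure K n.
Proof. by apply/comm_closureP => N; exists [:: (a, b)]; rewrite big_seq1. Qed.

Lemma comm_closureZ k a : a \in @comm_closure K n -> k *: a \in @comm_closure K n.
Proof.
move=> /comm_closureP ca; apply/comm_closureP => N; have [s sa] := ca N.
exists [seq (k *: p.1, p.2) | p <- s]; rewrite big_map /=.
apply: agree_trans (agreeZ k sa) _; rewrite scaler_sumr.
apply: agree_sum => p _; rewrite /brk -scalerAl -scalerAr -scalerBr.
exact: agree_refl.
Qed.

Lemma tocyc_conj (g a : A) : g [::] = 1 -> tocyc (conjnc g a) = tocyc a.
Proof.
move=> g1; apply/tocyc_eq0; have := comm_closure_brk (ninv g * a) g.
by rewrite /brk /conjnc [g * _]mulrA mulncV // mul1r.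
Qed.

Lemma rot_sum (R : nmodType) (f : seq 'I_n -> R) w k : (k <= size w)%N ->
  \sum_(r < size w) f (rot r (rot k w)) = \sum_(r < size w) f (rot r w).
Proof.
elim: k => [|k IH] kw; first by under eq_bigr do rewrite rot0.
rewrite -IH ?(ltnW kw) // rotS //; set x := rot k w.
have sx : size x = size w by rewrite size_rot.
rewrite -sx; case E : (size x) => [|m]; first by rewrite !big_ord0.
rewrite big_ord_recr [RHS]big_ord_recl addrC /= rot0; congr (_ + _).
  by apply: eq_bigr => r _; rewrite -(@rotD _ r 1 x) ?E addn1 // ltnS ltnW.
by rewrite -(@rotD _ m 1 x) ?E addn1 // -E rot_size.
Qed.

Definition cycsum w a : K := \sum_(r < (size w).-1.+1) a (rot r w).

Lemma cycsumD w a b : cycsum w (a + b) = cycsum w a + cycsum w b.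
Proof. by rewrite -big_split. Qed.
Lemma cycsumZ w k a : cycsum w (k *: a) = k * cycsum w a.
Proof. by rewrite mulr_sumr. Qed.
Lemma cycsumB w a b : cycsum w (a - b) = cycsum w a - cycsum w b.
Proof. by rewrite -scaleN1r cycsumD cycsumZ mulN1r. Qed.
Lemma cycsum0 w : cycsum w 0 = 0.
Proof. by rewrite /cycsum big1. Qed.
Lemma cycsum_sum w I (r : seq I) (P : pred I) (f : I -> A) :
  cycsum w (\sum_(i <- r | P i) f i) = \sum_(i <- r | P i) cycsum w (f i).
Proof. by apply: (big_morph _ (cycsumD w) (cycsum0 w)). Qed.
Lemma cycsum_agree w a b : agree (size w) a b -> cycsum w a = cycsum w b.
Proof. by move=> ab; apply: eq_bigr => r _; rewrite ab ?size_rot. Qed.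

Lemma cycsum_brk w a b : cycsum w (brk a b) = 0.
Proof.
rewrite cycsumB; apply/eqP; rewrite subr_eq0; apply/eqP; rewrite /cycsum.
have [->|w0] := eqVneq w [::].
  by rewrite !big_ord1 /= rot0 !nc_mul0E mulrC.
have -> : (size w).-1.+1 = size w by rewrite prednK // lt0n size_eq0.
under eq_bigr do rewrite nc_mulE size_rot.
under [RHS]eq_bigr do rewrite nc_mulE size_rot.
rewrite exchange_big [RHS]exchange_big /= (reindex_inj rev_ord_inj) /=.
apply: eq_bigr => k _; have kw : (k <= size w)%N by rewrite -ltnS.
rewrite subSS.
rewrite -(rot_sum (fun v => a (take (size w - k) v) * b (drop (size w - k) v)) kw).
apply: eq_bigr => r _; rewrite rot_rot; set v := rot r w.
have sv : size v = size w by rewrite size_rot.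
have sd : size (drop k v) = (size w - k)%N by rewrite size_drop sv.
by rewrite mulrC /rot (take_size_cat _ sd) (drop_size_cat _ sd).
Qed.

Lemma cycsum_closure w a : a \in @comm_closure K n -> cycsum w a = 0.
Proof.
move=> /comm_closureP/(_ (size w))[s sa].
by rewrite (cycsum_agree sa) cycsum_sum big1 // => p _; apply: cycsum_brk.
Qed.

Hypothesis charK : [pchar K] =i pred0.

Lemma closure_cycsum a : (forall w, cycsum w a = 0) -> a \in @comm_closure K n.
Proof.
move=> a0; apply/comm_closureP => N.
suff /comm_closureP/(_ N)[s sa] :
    \sum_(k < N.+1) \sum_(v : k.-tuple 'I_n) a v *: @mono K n v \in @comm_closure K n.
  by exists s; apply: agree_trans (@mono_approx K n N a) sa.
apply: rpred_sum => -[[|k] _] _ /=.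
  rewrite big1 ?rpred0 // => v _; rewrite tuple0 /=.
  by have := a0 [::]; rewrite /cycsum big_ord1 rot0 => ->; rewrite scale0r.
set S := \sum_(v : _) _.
suff -> : S = k.+1%:R^-1 *: \sum_(r < k.+1) \sum_(v : k.+1.-tuple 'I_n)
    a (rot r v) *: brk (mono K (drop r v)) (mono K (take r v)).
  apply/comm_closureZ/rpred_sum => r _; apply: rpred_sum => v _.
  exact/comm_closureZ/comm_closure_brk.
have -> : \sum_(r < k.+1) \sum_(v : k.+1.-tuple 'I_n)
    a (rot r v) *: brk (mono K (drop r v)) (mono K (take r v)) =
  \sum_(r < k.+1) S - \sum_(v : k.+1.-tuple 'I_n) cycsum v a *: mono K v :> A.
  rewrite [X in _ - X](_ : _ = \sum_(r < k.+1) \sum_(v : k.+1.-tuple 'I_n)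
    a (rot r v) *: mono K v); last first.
    rewrite exchange_big; apply: eq_bigr => v _.
    by rewrite /cycsum size_tuple scaler_suml.
  rewrite -sumrB; apply: eq_bigr => r _.
  have rI : injective (fun v : k.+1.-tuple 'I_n => [tuple of rot r v]).
    by move=> v v' /(congr1 val)/rot_inj/val_inj.
  rewrite [S in RHS](reindex_inj rI) -sumrB; apply: eq_bigr => v _ /=.
  by rewrite -scalerBr /brk -!mono_cat cat_take_drop.
rewrite [X in _ - X]big1 ?subr0; last by move=> v _; rewrite a0 scale0r.
by rewrite sumr_const card_ord -scaler_nat scalerA mulVf ?scale1r // natr_neq0.
Qed.

Lemma tocycP a b : tocyc a = tocyc b <-> forall w, cycsum w a = cycsum w b.
Proof.
rewrite tocyc_eq0; split=> [ab w|ab].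
  by apply/eqP; rewrite -subr_eq0 -cycsumB cycsum_closure.
by apply: closure_cycsum => w; rewrite cycsumB ab subrr.
Qed.

End Cyclic.

Section CyclicMaps.
Variable K : fieldType.

Lemma cmorph_closure m n (T : ncps K m -> ncps K n) a : cmorph T ->
  a \in @comm_closure K m -> T a \in @comm_closure K n.
Proof.
move=> aT /comm_closureP ca; have [cT _ _] := aT; apply/comm_closureP => N.
have [s sa] := ca N; exists [seq (T p.1, T p.2) | p <- s]; rewrite big_map /=.
apply: agree_trans (clinear_agree cT sa) _; rewrite (clinear_sum cT).
by apply: agree_sum => p _; rewrite cmorph_brk.
Qed.

Lemma tocyc_cmorph m n (T : ncps K m -> ncps K n) a b : cmorph T ->
  tocyc a = tocyc b -> tocyc (T a) = tocyc (T b).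
Proof.
move=> aT /tocyc_eq0 ab; apply/tocyc_eq0; have [cT _ _] := aT.
by rewrite -(clinearB cT); apply: cmorph_closure.
Qed.

Lemma cyc_act_tocyc n (F : 'I_n -> ncps K n) a :
  cyc_act F (tocyc a) = tocyc (act F a).
Proof.
by apply: tocyc_cmorph; [apply: act_cmorph|rewrite tocyc_repr].
Qed.

End CyclicMaps.

(** * Derivations *)

Section Derivations.
Lemma addrB2 (V : zmodType) (x y z t : V) : x + y - (z + t) = (x - z) + (y - t).
Proof. by rewrite opprD addrACA. Qed.

Variable K : fieldType.

Definition sderivation m n (S D : ncps K m -> ncps K n) :=
  forall a b, D (a * b) = D a * S b + S a * D b.

Lemma sderivation1 m n (S D : ncps K m -> ncps K n) :
  cmorph S -> sderivation S D -> D 1 = 0.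
Proof.
move=> [_ S1 _] dD; apply: (addrI (D 1)).
by rewrite addr0 -{3}[1]mulr1 dD S1 mulr1 mul1r.
Qed.

Lemma sderivation_ext m n (S D D' : ncps K m -> ncps K n) :
  cmorph S -> clinear D -> clinear D' -> sderivation S D -> sderivation S D' ->
  (forall i, D (ncX K i) = D' (ncX K i)) -> D =1 D'.
Proof.
move=> aS cD cD' dD dD' DD; apply: clinear_ext => // v.
elim: v => [|i v IH]; first by rewrite /mono big_nil !(sderivation1 aS).
by rewrite monoS dD dD' IH DD.
Qed.

Variable n : nat.
Local Notation A := (ncps K n).
Implicit Types (u v : 'I_n -> A) (a b : A).

Lemma clinear_rho u : clinear (rho u). Proof. exact: clinear_clin. Qed.

Lemma commutator_derivation (D D' : A -> A) : clinear D -> clinear D' ->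
  derivation D -> derivation D' -> derivation (fun a => D (D' a) - D' (D a)).
Proof.
move=> cD cD' dD dD' a b; rewrite dD' dD (clinearD cD) (clinearD cD') !dD !dD'.
have shuffle (x1 x2 x3 x4 x5 x6 : A) :
    x1 + x2 + (x3 + x4) - (x5 + x3 + (x2 + x6)) = x1 - x5 + (x4 - x6).
  rewrite (addrACA x5) opprD addrACA !opprD [x1 + x2 + _]addrACA.
  by rewrite subrr addr0 [x3 + x4 + _]addrACA subrr add0r.
by rewrite shuffle mulrBl mulrBr.
Qed.

Lemma derivation_ext (D D' : A -> A) : clinear D -> clinear D' ->
  derivation D -> derivation D' ->
  (forall i, D (ncX K i) = D' (ncX K i)) -> D =1 D'.
Proof. exact: sderivation_ext (cmorph_id _ _). Qed.

Lemma clinear_commutator (D D' : A -> A) : clinear D -> clinear D' ->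
  clinear (fun a => D (D' a) - D' (D a)).
Proof.
move=> cD cD'; apply: clinear_add; first exact: clinear_comp.
by apply: clinear_opp; apply: clinear_comp.
Qed.

(** The bracket of [tDer]. *)
Definition tbrk v u i : A := brk (v i) (u i) + (rho v (u i) - rho u (v i)).

Lemma rho_nil u a : (forall i, u i [::] = 0) -> rho u a [::] = 0.
Proof.
move=> u0; have /= := @rho_raises _ _ _ u0 0 a; rewrite addn0; apply => //.
Qed.

Lemma tbrk_nil v u i : (forall i, v i [::] = 0) -> (forall i, u i [::] = 0) ->
  tbrk v u i [::] = 0.
Proof.
move=> v0 u0; rewrite /tbrk /brk !nc_addE !nc_oppE !nc_mul0E !rho_nil // u0 v0.
by rewrite !mulr0 !subrr addr0.
Qed.

Lemma rho_derivation u : (forall i, u i [::] = 0) -> derivation (rho u).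
Proof. by move=> u0 a b; apply: rhoM. Qed.

Lemma derivation_brkr c : derivation (fun a => brk a c).
Proof.
by move=> a b; rewrite /brk mulrBl mulrBr !mulrA [RHS]addrC addrA subrK.
Qed.

Lemma jacobi a b c : brk (brk a b) c = brk (brk a c) b + brk a (brk b c).
Proof. exact: derivation_brk (clinear_brkr _) (@derivation_brkr c). Qed.

Lemma brkD a b c : brk a (b + c) = brk a b + brk a c.
Proof. by rewrite /brk mulrDr mulrDl opprD addrACA. Qed.
Lemma brkN a b : brk a (- b) = - brk a b.
Proof. by rewrite /brk mulrN mulNr opprB opprK addrC. Qed.

Lemma rho_commutator v u : (forall i, v i [::] = 0) -> (forall i, u i [::] = 0) ->
  forall a, rho v (rho u a) - rho u (rho v a) = rho (tbrk v u) a.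
Proof.
move=> v0 u0.
have dv := rho_derivation v0; have du := rho_derivation u0.
have [cv cu] := (clinear_rho v, clinear_rho u).
apply: derivation_ext => [||||i].
- exact: clinear_commutator.
- exact: clinear_rho.
- exact: commutator_derivation.
- by apply: rho_derivation => i; apply: tbrk_nil.
have t0 k : tbrk v u k [::] = 0 by apply: tbrk_nil.
rewrite (rhoX u0) (rhoX v0) (rhoX t0) (derivation_brk _ _ cv dv).
rewrite (derivation_brk _ _ cu du) (rhoX v0) (rhoX u0) (jacobi _ (v i)).
by rewrite /tbrk !brkD !brkN addrB2 (addrC (brk (brk _ _) _)) addrK.
Qed.

Lemma euler_rho u : (forall i, u i [::] = 0) ->
  forall a, euler (rho u a) - rho u (euler a) = rho (fun i => euler (u i)) a.
Proof.
move=> u0; have e0 i : euler (u i) [::] = 0 by apply: euler_nil.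
have [cE cu] := (@clinear_euler K n, clinear_rho u).
have dE := @derivation_euler K n; have du := rho_derivation u0.
apply: derivation_ext => [||||i].
- exact: clinear_commutator.
- exact: clinear_rho.
- exact: commutator_derivation.
- exact: rho_derivation.
rewrite eulerX (rhoX u0) (rhoX e0) (derivation_brk _ _ cE dE) eulerX.
by rewrite addrC addKr.
Qed.

(** * The exponential of [tDer] *)

Lemma Lie_rho u a : tDer u -> Lie a -> Lie (rho u a).
Proof.
move=> tu; have u0 i := lie_nil (tu i); apply: Lie_derivation.
- exact: clinear_rho.
- exact: rho_derivation.
- by move=> i; rewrite rhoX //; apply: Lie_brk; [apply: LieX|apply: tu].
Qed.

Fixpoint tad_euler u j : 'I_n -> A :=
  if j is j'.+1 then tbrk (tad_euler u j') u else fun i => euler (u i).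

Lemma tDer_tad_euler u j : tDer u -> tDer (tad_euler u j).
Proof.
move=> tu; elim: j => [|j IH] i; first by apply: Lie_euler; apply: tu.
apply: LieD; first exact: Lie_brk.
by apply: LieD; [|apply: LieN]; apply: Lie_rho.
Qed.

Lemma texpE1 u i : (forall i, u i [::] = 0) ->
  texp u i = opexp (fun a => u i * a + rho u a) 1 1.
Proof.
move=> u0; rewrite -(texpE u 1 i); congr (texp _ _).
by apply/funext => k; rewrite scale1r.
Qed.

Lemma texp_nil u i : (forall i, u i [::] = 0) -> texp u i [::] = 1.
Proof. by move=> u0; rewrite texpE1 // opexp_nil. Qed.

Lemma texp0 : texp (fun=> 0 : A) = @tid K n.
Proof.
have z0 (i : 'I_n) : (0 : A) [::] = 0 by [].
have rho0 a : rho (fun=> 0 : A) a = 0.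
  by have := rhoZ (fun=> 0 : A) 0 a; rewrite !scale0r.
apply/funext => i; rewrite texpE1 //; apply/funext => w.
rewrite /opexp big_ord_recl divff ?oner_eq0 // mul1r big1 ?addr0 // => k _ /=.
by rewrite rho0 mul0r addr0 mulr0.
Qed.

Lemma tDerZ u t : tDer u -> tDer (fun i => t *: u i).
Proof. by move=> tu i; apply: LieZ. Qed.
Lemma tDerN u : tDer u -> tDer (fun i => - u i).
Proof. by move=> tu i; apply: LieN. Qed.

Hypothesis charK : [pchar K] =i pred0.

Lemma TAut_texp u : tDer u -> TAut (texp u).
Proof.
move=> tu i; have u0 k := lie_nil (tu k).
have y0 j k : tad_euler u j k [::] = 0 by apply: lie_nil; apply: tDer_tad_euler.
apply/(grouplikeP charK); first exact: texp_nil.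
pose M a := u i * a + rho u a.
pose Y j a := tad_euler u j i * a + rho (tad_euler u j) a.
pose b := csum (fun j => j.+1`!%:R^-1 *: tad_euler u j i).
have cM : clinear M.
  by apply: clinear_add; [apply: clinear_mull (clinear_id _ _)|apply: clinear_rho].
have rM : raises 1 M by apply: M_raises.
have Y0 a : Y 0%N a = euler (M a) - M (euler a).
  by rewrite /M (clinearD (@clinear_euler K n)) derivation_euler addrB2 addrK euler_rho.
have YS j a : Y j.+1 a = Y j (M a) - M (Y j a).
  have yd := rho_derivation (y0 j); have ud := rho_derivation u0.
  rewrite /Y /M /= -rho_commutator // /tbrk /brk.
  rewrite (clinearD (clinear_rho _)) (clinearD (clinear_rho _)) yd ud !mulrDr.
  rewrite !addrB2 !mulrDl !mulNr !mulrA !addrA; congr (_ + _).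
  have shuffle (x y z s t : A) : x + y - z + s - t + z - y = x + s - t.
    rewrite -[x + y - z]addrA -[_ + z - y]addrA -[z - y]opprB.
    by rewrite (addrAC x _ s) (addrAC (x + s)) addrK.
  by rewrite shuffle.
have yv j : vanish j.+1 (tad_euler u j i).
  have := Yk_vanish rM Y0 YS (k := j) 1.
  by rewrite /Y mulr1 rho1 // addr0; apply.
exists (opexp (rho u) 1 b).
  apply: Lie_opexp => //; [exact: clinear_rho|exact: rho_raises| |].
    by move=> a; apply: Lie_rho.
  apply: Lie_csum => k; last by apply: LieZ; apply: tDer_tad_euler.
  by apply: vanishZ; apply: (vanishW (leqnSn k)).
rewrite texpE1 // (euler_opexp charK cM rM Y0 YS) euler1 add0r.
have -> : csum (fun k => k.+1`!%:R^-1 *: Y k 1) = 1 * b.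
  by rewrite mul1r; congr csum; apply/funext => k; rewrite /Y mulr1 rho1 // addr0.
apply: (opexpM charK); [exact: cM.1|exact: rM|exact: rho_lin|exact: rho_raises|].
exact: M_mul.
Qed.

End Derivations.

Section PolyChar0.
Variable K : fieldType.
Hypothesis charK : [pchar K] =i pred0.

Lemma natr_inj : injective (fun k : nat => k%:R : K).
Proof.
have H k l : (k <= l)%N -> k%:R = l%:R :> K -> k = l.
  move=> kl /eqP; rewrite -(subnKC kl) natrD -[X in X == _]addr0.
  rewrite (inj_eq (addrI _)) eq_sym ((pcharf0P K).1 charK) => /eqP ->.
  by rewrite addn0.
by move=> k l kl; case/orP: (leq_total k l) => /H; [apply|move/(_ (esym kl))].
Qed.

Lemma poly_horner_inj (p q : {poly K}) : (forall t, p.[t] = q.[t]) -> p = q.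
Proof.
move=> pq; apply/eqP; rewrite -subr_eq0; apply/negPn/negP => d0.
set d := p - q in d0.
have := max_poly_roots (rs := [seq k%:R | k <- iota 0 (size d)]) d0.
rewrite size_map size_iota ltnn (map_inj_uniq natr_inj) iota_uniq => H.
suff /H/(_ isT) : all (root d) [seq k%:R | k <- iota 0 (size d)] by [].
by apply/allP => x _; rewrite rootE /d hornerD hornerN pq subrr.
Qed.

Lemma deriv_inj (p q : {poly K}) : p^`() = q^`() -> p.[0] = q.[0] -> p = q.
Proof.
rewrite !horner_coef0 => pq pq0; apply/polyP => -[//|k].
have /(congr1 (fun r : {poly K} => r`_k)) := pq; rewrite !coef_deriv.
rewrite -[p`_k.+1 *+ _]mulr_natr -[q`_k.+1 *+ _]mulr_natr.
by apply: mulIf; apply: natr_neq0.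
Qed.
End PolyChar0.

Section CocycleExp.
Variables (K : fieldType) (n : nat).
Hypothesis charK : [pchar K] =i pred0.
Local Notation A := (ncps K n).
Implicit Types (u : 'I_n -> A) (a b : A).

Lemma texp1 u : texp (fun i => 1 *: u i) = texp u.
Proof. by congr texp; apply/funext => i; rewrite scale1r. Qed.

Lemma tinv_texp u : tDer u -> tinv (texp u) = texp (fun i => - u i).
Proof.
move=> tu; have tNu := tDerN tu.
have N1 : (fun i => -1 *: u i) = (fun i => - u i).
  by apply/funext => i; rewrite scaleN1r.
have z (s t : K) : s + t = 0 -> texp (fun i => (s + t) *: u i) = @tid K n.
  move=> ->; rewrite -(texp0 K n); congr texp.
  by apply/funext => i; rewrite scale0r.
apply: tinv_eq; [exact: TAut_texp|exact: TAut_texp| |].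
  have := texpD 1 (-1) charK tu; rewrite z ?subrr // N1 => ->.
  by rewrite texp1.
have := texpD (-1) 1 charK tu; rewrite z ?addNr // N1 => ->.
by rewrite texp1.
Qed.

Definition divrep u : A := \sum_i ncX K i * rcoef i (u i).

Lemma divergenceE u : divergence u = tocyc (divrep u).
Proof. by rewrite tocyc_sum. Qed.

(** [\int_0^1 exp(t rho(u)) (div u) dt], integrated term by term. *)
Definition jrep u : A :=
  csum (fun k => k.+1`!%:R^-1 *: iter k (rho u) (divrep u)).

Lemma cycsum_clinear w (T : A -> A) a : clinear T ->
  cycsum w (T a) = \sum_(k < (size w).+1) \sum_(v : k.-tuple 'I_n)
    a v * cycsum w (T (mono K v)).
Proof.
move=> cT.
rewrite (cycsum_agree (clinear_agree cT (@mono_approx K n (size w) a))).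
rewrite (clinear_sum cT) cycsum_sum; apply: eq_bigr => k _.
rewrite (clinear_sum cT) cycsum_sum; apply: eq_bigr => v _.
by rewrite (clinearZ cT) cycsumZ.
Qed.

Variable j : ('I_n -> A) -> cyc K n.
Hypothesis jP : div_cocycle j.

Lemma j_tid : j (@tid K n) = 0.
Proof.
have := jP.1 _ _ (@TAut_tid K n) (@TAut_tid K n); rewrite tcomp1.
rewrite -{3}(tocyc_repr (j _)) cyc_act_tocyc act_tid tocyc_repr.
by move/eqP; rewrite -[X in X == _]addr0 (inj_eq (addrI _)) => /eqP.
Qed.

(* The cyclic sums of [j (texp (t u))] are polynomials in [t], determined by
   their derivative, which the cocycle identity expresses by the divergence. *)
Lemma j_texp u : tDer u -> j (texp u) = tocyc (jrep u).
Proof.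
move=> tu; have u0 i := lie_nil (tu i).
have [p [jp dp]] := jP.2 u tu; rewrite divergenceE in dp.
pose pt t : A := fun w => (p w).[t].
have cO t : clinear (opexp (rho u) t).
  apply: clinear_raises; first exact: opexp_lin (rho_lin u).
  exact: opexp_raises (rho_raises u0).
have addp s t w :
    cycsum w (pt (s + t)) = cycsum w (pt s) + cycsum w (opexp (rho u) s (pt t)).
  rewrite -cycsumD; apply: (iffLR (tocycP charK _ _)); rewrite tocycD -!jp texpD //.
  rewrite jP.1; [|exact/(TAut_texp charK)/tDerZ|exact/(TAut_texp charK)/tDerZ].
  by rewrite (jp t) cyc_act_tocyc act_texp.
rewrite -texp1 jp; apply/(tocycP charK) => w; set N := size w.
pose P := \sum_(r < (size w).-1.+1) p (rot r w).
have PE t : P.[t] = cycsum w (pt t) by rewrite horner_sum.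
pose Q := \sum_(k < N.+1)
  (k.+1`!%:R^-1 * cycsum w (iter k (rho u) (divrep u))) *: 'X^(k.+1) : {poly K}.
suff PQ : P = Q.
  transitivity P.[1]; first by rewrite PE.
  rewrite PQ horner_sum /jrep.
  rewrite (cycsum_agree (csum_agree (N := N) _)); last first.
    by move=> k; apply: vanishZ; apply: iter_vanish; apply: rho_raises.
  rewrite cycsum_sum; apply: eq_bigr => k _.
  by rewrite hornerZ hornerXn expr1n mulr1 cycsumZ.
apply: (deriv_inj charK); last first.
  rewrite PE horner_sum [RHS]big1; last by move=> k _; rewrite !hornerE expr0n mulr0.
  rewrite -[RHS](cycsum0 _ w); apply: (iffLR (tocycP charK _ _)); rewrite -jp tocyc0.
  rewrite -j_tid -(texp0 K n); congr (j (texp _)).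
  by apply/funext => i; rewrite scale0r.
apply: (poly_horner_inj charK) => s.
transitivity (cycsum w (opexp (rho u) s (divrep u))).
  pose R := (P.[s])%:P + \sum_(k < N.+1) \sum_(v : k.-tuple 'I_n)
     (cycsum w (opexp (rho u) s (mono K v))) *: p v.
  have PR : P \Po ('X + s%:P) = R.
    apply: (poly_horner_inj charK) => t; rewrite horner_comp !hornerE.
    rewrite (PE (t + s)) (addrC t) addp -PE; congr (_ + _).
    rewrite (cycsum_clinear _ _ (cO s)) horner_sum; apply: eq_bigr => k _.
    by rewrite horner_sum; apply: eq_bigr => v _; rewrite hornerZ mulrC.
  have /(congr1 (fun q : {poly K} => q^`().[0])) := PR.
  rewrite deriv_comp derivD derivX derivC addr0 mulr1 horner_comp !hornerE /=.
  move=> ->.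
  rewrite derivD derivC add0r.
  pose d0 : A := fun w => (p w)^`().[0].
  have -> : cycsum w (opexp (rho u) s (divrep u)) = cycsum w (opexp (rho u) s d0).
    apply: (iffLR (tocycP charK _ _)).
    by rewrite -!act_texp //; apply: tocyc_cmorph; [exact: act_cmorph|].
  rewrite (cycsum_clinear _ _ (cO s)) raddf_sum /= horner_sum; apply: eq_bigr => k _.
  rewrite raddf_sum /= horner_sum; apply: eq_bigr => v _.
  by rewrite derivZ hornerZ mulrC.
rewrite raddf_sum /= horner_sum.
rewrite (cycsum_agree (opexpE (N := N) s _ (rho_raises u0))) // cycsum_sum.
apply: eq_bigr => k _; rewrite cycsumZ derivZ derivXn hornerZ hornerMn hornerXn /=.
rewrite -[s ^+ k *+ _]mulr_natr factS natrM invfM [RHS]mulrC -!mulrA.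
by rewrite mulVKf ?natr_neq0.
Qed.

End CocycleExp.

Section RightCoef.
Variables (K : fieldType) (n : nat).
Local Notation A := (ncps K n).
Implicit Types a b c : A.

Lemma rcoefD l a b : rcoef l (a + b) = rcoef l a + rcoef l b.
Proof. by []. Qed.
Lemma rcoef_sum l I (r : seq I) (P : pred I) (f : I -> A) :
  rcoef l (\sum_(i <- r | P i) f i) = \sum_(i <- r | P i) rcoef l (f i).
Proof. by apply: (big_morph (rcoef l)). Qed.

Lemma rcoef_scalar l k : rcoef l (k *: 1 : A) = 0.
Proof.
apply/funext => w; rewrite /rcoef nc_scaleE nc_oneE -size_eq0 size_rcons.
by rewrite mulr0.
Qed.

Lemma rcoef_mulX l m c : rcoef l (c * ncX K m) = (l == m)%:R *: c.
Proof.
apply/funext => w; rewrite /rcoef nc_mulE nc_scaleE size_rcons.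
have kw : (size w < (size w).+2)%N by rewrite ltnS.
rewrite (bigD1 (Ordinal kw)) //= big1 ?addr0 => [|k wk].
  rewrite -cats1 take_size_cat // drop_size_cat // /ncX.
  by rewrite eqseq_cons eqxx andbT mulrC.
rewrite /ncX; case: eqP => [dm|]; rewrite ?mulr0 //; case/eqP: wk.
apply: val_inj => /=; have := congr1 size dm; rewrite size_drop size_rcons /=.
have : (k <= (size w).+1)%N by rewrite -ltnS.
by move=> /subnKC e d1; move: e; rewrite d1 addn1 => -[].
Qed.

Lemma nc_decomp a : a = a [::] *: 1 + \sum_i rcoef i a * ncX K i.
Proof.
apply/funext => w; case/lastP: w => [|w l].
  rewrite nc_addE nc_scaleE nc_oneE mulr1 nc_sumE big1 ?addr0 // => i _.
  by rewrite nc_mul0E mulr0.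
rewrite -[LHS]/(rcoef l a w) -[RHS]/(rcoef l (_ + _) w) rcoefD rcoef_scalar add0r.
rewrite rcoef_sum nc_sumE (bigD1 l) //= rcoef_mulX eqxx scale1r big1 ?addr0 //.
by move=> i il; rewrite rcoef_mulX eq_sym (negbTE il) scale0r.
Qed.
End RightCoef.

(** * Cabling *)

Section Cable.
Variables (K : fieldType) (n : nat).
Hypothesis charK : [pchar K] =i pred0.
Local Notation A := (ncps K n).
Implicit Types (u : 'I_2 -> ncps K 2) (i l : 'I_n) (b : 'I_2).

Definition tail (k : nat) : A := \sum_(l < n | (k <= l)%N) ncX K l.

(** [x_l] is one of the letters replacing the variable [b] of [A_2]. *)
Definition strand i b l := if b == ord0 then l == i else (i < l)%N.

Definition cabling i b : A := if b == ord0 then ncX K i else tail i.+1.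

Lemma cabling_sum i b : cabling i b = \sum_(l | strand i b l) ncX K l.
Proof.
by rewrite /cabling /strand; case: eqP => // _; rewrite big_pred1_eq.
Qed.

Lemma tail_nil k : tail k [::] = 0.
Proof. by rewrite /tail nc_sumE big1. Qed.

Lemma cabling_nil i b : cabling i b [::] = 0.
Proof. by rewrite /cabling; case: ifP => // _; apply: tail_nil. Qed.

Lemma cabling_cmorph i : cmorph (subst (cabling i)).
Proof. exact: subst_cmorph (cabling_nil i). Qed.

Lemma cabling_clinear i : clinear (subst (cabling i)).
Proof. by case: (cabling_cmorph i). Qed.

Lemma ord2P b : b = ord0 \/ b = ord_max.
Proof. by case: b => [[|[|//]]] ?; [left|right]; apply: val_inj. Qed.

Lemma cable_strand u i b l : strand i b l -> cable u i l = subst (cabling i) (u b).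
Proof.
rewrite /cable /strand; case: (ord2P b) => -> /=.
  by move=> /eqP ->; rewrite ltnn eqxx.
by move=> il; rewrite ltnNge ltnW //= ifN // -val_eqE /= gtn_eqF.
Qed.

Lemma cable_lt u i l : (l < i)%N -> cable u i l = 0.
Proof. by rewrite /cable => ->. Qed.

Lemma strand_uniq i b b' l : strand i b l -> strand i b' l -> b = b'.
Proof.
rewrite /strand; case: (ord2P b) => ->; case: (ord2P b') => -> //=.
  by move=> /eqP ->; rewrite ltnn.
by move=> + /eqP il; rewrite il ltnn.
Qed.

Lemma strandP i l : (l < i)%N \/ exists b, strand i b l.
Proof.
case: (ltngtP l i) => il; first by left.
  by right; exists ord_max.
by right; exists ord0; apply/eqP/val_inj.
Qed.

Lemma tDer_cable u i : tDer u -> tDer (cable u i).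
Proof.
move=> tu l; have [li|[b bl]] := strandP i l.
  by rewrite cable_lt //; apply: Lie0.
rewrite (cable_strand _ bl); apply: Lie_cmorph; [exact: cabling_cmorph| |exact: tu].
move=> k; rewrite substX ?cabling_sum; last exact: cabling_nil.
by apply: Lie_sum => m _; apply: LieX.
Qed.

Lemma rho_cable u i a : tDer u ->
  rho (cable u i) (subst (cabling i) a) = subst (cabling i) (rho u a).
Proof.
move=> tu; have cs := cabling_clinear i; have ms := cabling_cmorph i.
have [_ _ sM] := ms.
have u0 b := lie_nil (tu b); have c0 l := lie_nil (tDer_cable i tu l).
have [cr cc] := (clinear_rho u, clinear_rho (cable u i)).
move: a; apply: (sderivation_ext ms) => [||a b|a b|b].
- exact: clinear_comp.
- exact: clinear_comp.
- by rewrite sM rho_derivation.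
- by rewrite rho_derivation // (clinearD cs) !sM.
rewrite substX; last exact: cabling_nil.
rewrite (rhoX u0) (cmorph_brk _ _ ms) substX; last exact: cabling_nil.
rewrite cabling_sum (clinear_sum cc) /brk mulr_suml mulr_sumr -sumrB.
by apply: eq_bigr => l bl; rewrite (rhoX c0) (cable_strand _ bl).
Qed.

Lemma rcoef_cabling i b l a : strand i b l ->
  rcoef l (subst (cabling i) a) = subst (cabling i) (rcoef b a).
Proof.
move=> bl; have cs := cabling_clinear i; have [_ s1 sM] := cabling_cmorph i.
rewrite {1}(nc_decomp a) (clinearD cs) (clinearZ cs) s1 rcoefD rcoef_scalar add0r.
rewrite (clinear_sum cs) rcoef_sum (bigD1 b) //= [X in _ + X]big1 ?addr0.
  rewrite sM substX ?cabling_sum; last exact: cabling_nil.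
  rewrite mulr_sumr rcoef_sum (bigD1 l) //= rcoef_mulX eqxx scale1r big1 ?addr0 //.
  by move=> m /andP[_ ml]; rewrite rcoef_mulX eq_sym (negbTE ml) scale0r.
move=> b' b'b; rewrite sM substX ?cabling_sum; last exact: cabling_nil.
rewrite mulr_sumr rcoef_sum big1 // => m b'm; rewrite rcoef_mulX.
have [lm|_] := eqVneq l m; last by rewrite scale0r.
by rewrite -lm in b'm; rewrite (strand_uniq bl b'm) eqxx in b'b.
Qed.

Lemma divrep_cable u i : tDer u ->
  divrep (cable u i) = subst (cabling i) (divrep u).
Proof.
move=> tu; have cs := cabling_clinear i; have [_ s1 sM] := cabling_cmorph i.
rewrite /divrep (clinear_sum cs).
transitivity (\sum_b \sum_(l | strand i b l)
    ncX K l * rcoef l (subst (cabling i) (u b))); last first.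
  apply: eq_bigr => b _; rewrite sM substX ?cabling_sum; last exact: cabling_nil.
  by rewrite mulr_suml; apply: eq_bigr => l bl; rewrite (rcoef_cabling _ bl).
rewrite (exchange_big_dep xpredT) //=; apply: eq_bigr => l _.
have [li|[b bl]] := strandP i l.
  rewrite cable_lt // mulr0 big_pred0 // => b.
  rewrite /strand; case: ifP => _; last by rewrite ltnNge ltnW.
  by rewrite -val_eqE ltn_eqF.
rewrite (big_pred1 b) ?(cable_strand _ bl) // => b'.
apply/idP/eqP => [b'l|-> //]; exact: strand_uniq b'l bl.
Qed.

Lemma iter_rho_cable u i k a : tDer u ->
  iter k (rho (cable u i)) (subst (cabling i) a) =
  subst (cabling i) (iter k (rho u) a).
Proof. by move=> tu; elim: k => // k IH; rewrite /= IH rho_cable. Qed.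

Lemma jrep_cable u i : tDer u -> jrep (cable u i) = subst (cabling i) (jrep u).
Proof.
move=> tu; have cs := cabling_clinear i.
rewrite /jrep (clinear_csum cs) => [|k].
  apply/funext => w; apply: eq_bigr => k _.
  by rewrite divrep_cable // iter_rho_cable // (clinearZ cs).
by apply: vanishZ; apply: iter_vanish; apply: rho_raises => b; apply: lie_nil.
Qed.

Lemma act_texp1 m (u : 'I_m -> ncps K m) a : tDer u ->
  act (texp u) a = opexp (rho u) 1 a.
Proof.
by move=> tu; rewrite -texp1 act_texp // => l; apply: lie_nil.
Qed.

Lemma act_cable u i a : tDer u ->
  act (texp (cable u i)) (subst (cabling i) a) =
  subst (cabling i) (act (texp u) a).
Proof.
move=> tu; have tc := tDer_cable i tu; have cs := cabling_clinear i.
rewrite !act_texp1 // [in RHS]opexp_csum (clinear_csum cs) => [|k].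
  apply/funext => w; apply: eq_bigr => k _.
  by rewrite iter_rho_cable // -nc_scaleE (clinearZ cs).
by apply: vanishZ; apply: iter_vanish; apply: rho_raises => b; apply: lie_nil.
Qed.

Lemma act_cable_lt u i l : tDer u -> (l < i)%N ->
  act (texp (cable u i)) (ncX K l) = ncX K l.
Proof.
move=> tu li; have tc := tDer_cable i tu; have c0 k := lie_nil (tc k).
rewrite act_texp1 // opexp_csum.
have Z k : iter k.+1 (rho (cable u i)) (ncX K l) = 0.
  elim: k => [|k IH]; last by rewrite iterS IH (clinear0 (clinear_rho _)).
  by rewrite /= (rhoX c0) cable_lt // /brk mulr0 mul0r subr0.
apply/funext => w; rewrite /csum big_ord_recl divff ?oner_eq0 // scale1r /=.
by rewrite big1 ?addr0 // => k _; rewrite -iterS Z scaler0.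
Qed.

(* The components of [cable u i] above [i] are all equal, hence so are those of
   its exponential. *)
Lemma act_cable_gt u i : tDer u -> exists2 g : A, g [::] = 1 &
  forall l, (i < l)%N -> act (texp (cable u i)) (ncX K l) = conjnc g (ncX K l).
Proof.
move=> tu; have tc := tDer_cable i tu; have c0 k := lie_nil (tc k).
exists (opexp (fun a => subst (cabling i) (u ord_max) * a + rho (cable u i) a) 1 1).
  by rewrite opexp_nil.
by move=> l il; rewrite actX (texpE1 l c0) (@cable_strand u i ord_max) //.
Qed.

Lemma cableN u i : cable (fun b => - u b) i = (fun l => - cable u i l).
Proof.
apply/funext => l; have [li|[b bl]] := strandP i l.
  by rewrite !cable_lt // oppr0.
by rewrite !(cable_strand _ bl) (clinearN (cabling_clinear i)).
Qed.

Lemma tailS i : tail i = ncX K i + tail i.+1.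
Proof.
rewrite /tail (bigD1 i) //=; congr (_ + _); apply: eq_bigl => l.
by rewrite ltn_neqAle andbC -val_eqE eq_sym.
Qed.

Lemma tail_ge k : (n <= k)%N -> tail k = 0.
Proof.
move=> nk; rewrite /tail big_pred0 // => l; apply/negbTE; rewrite -ltnNge.
exact: leq_trans (ltn_ord l) nk.
Qed.

End Cable.

(** * The element F^(n) and its inverse *)

Section Products.
Variables (K : fieldType) (n : nat).
Hypothesis charK : [pchar K] =i pred0.
Local Notation A := (ncps K n).
Local Notation T := ('I_n -> A).
Implicit Types (f g : 'I_n -> T) (k : nat) (i l : 'I_n).

Definition dprod f k : T :=
  \big[@tcomp K n/@tid K n]_(i <- rev (drop k (enum 'I_n)) | (i.+1 < n)%N) f i.
Definition iprod f k : T :=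
  \big[@tcomp K n/@tid K n]_(i <- drop k (enum 'I_n) | (i.+1 < n)%N) f i.

Lemma drop_enum i : drop i (enum 'I_n) = i :: drop i.+1 (enum 'I_n).
Proof.
by rewrite (drop_nth i) ?size_enum_ord // nth_ord_enum.
Qed.

Lemma TAut_big I (r : seq I) (P : pred I) (f : I -> T) :
  (forall x, P x -> TAut (f x)) -> TAut (\big[@tcomp K n/@tid K n]_(x <- r | P x) f x).
Proof.
move=> tf; apply: big_ind => //; first exact: TAut_tid.
by move=> F G; apply: TAut_tcomp.
Qed.

Lemma tcomp_big_cat I (r1 r2 : seq I) (P : pred I) (f : I -> T) :
  (forall x, P x -> TAut (f x)) ->
  \big[@tcomp K n/@tid K n]_(x <- r1 ++ r2 | P x) f x =
  tcomp (\big[@tcomp K n/@tid K n]_(x <- r1 | P x) f x)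
    (\big[@tcomp K n/@tid K n]_(x <- r2 | P x) f x).
Proof.
move=> tf; elim: r1 => [|x r1 IH]; first by rewrite big_nil tcomp1l.
rewrite cat_cons !big_cons; case: ifP => // Px; rewrite IH tcompA //.
  by move=> l; apply: TAut_nil; apply: tf.
by move=> l; apply: TAut_nil; apply: TAut_big.
Qed.

Lemma iprodS f i : (i.+1 < n)%N -> iprod f i = tcomp (f i) (iprod f i.+1).
Proof. by move=> i1; rewrite /iprod drop_enum big_cons i1. Qed.

Lemma dprodS f i : (forall l, TAut (f l)) -> (i.+1 < n)%N ->
  dprod f i = tcomp (dprod f i.+1) (f i).
Proof.
move=> tf i1; rewrite /dprod drop_enum rev_cons -cats1 tcomp_big_cat; last by [].
by rewrite big_cons i1 big_nil tcomp1.
Qed.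

Lemma iprod_last f i : ~~ (i.+1 < n)%N -> iprod f i = @tid K n.
Proof.
move=> i1; rewrite /iprod drop_enum big_cons (negbTE i1) drop_oversize ?big_nil //.
by rewrite size_enum_ord leqNgt.
Qed.

Lemma dprod_last f i : ~~ (i.+1 < n)%N -> dprod f i = @tid K n.
Proof.
move=> i1; rewrite /dprod drop_enum drop_oversize; last first.
  by rewrite size_enum_ord leqNgt.
by rewrite rev_cons /= big_cons (negbTE i1) big_nil.
Qed.

Lemma ord_down_ind (P : 'I_n -> Prop) :
  (forall i, ~~ (i.+1 < n)%N -> P i) ->
  (forall i i', (i.+1 < n)%N -> i' = i.+1 :> nat -> P i' -> P i) ->
  forall i, P i.
Proof.
move=> P0 PS i; have [d] := ubnP (n - i); elim: d i => // d IH i id.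
have [i1|i1] := boolP (i.+1 < n)%N; last exact: P0.
apply: (PS i (Ordinal i1)) => //; apply: IH => /=.
by rewrite -ltnS (leq_trans _ id) // ltnS ltn_sub2l.
Qed.

Lemma TAut_iprod f k : (forall l, TAut (f l)) -> TAut (iprod f k).
Proof. by move=> tf; apply: TAut_big. Qed.
Lemma TAut_dprod f k : (forall l, TAut (f l)) -> TAut (dprod f k).
Proof. by move=> tf; apply: TAut_big. Qed.

Lemma dprod_iprod f g i : (forall l, TAut (f l)) -> (forall l, TAut (g l)) ->
  (forall l, tcomp (f l) (g l) = @tid K n) ->
  (forall l, tcomp (g l) (f l) = @tid K n) ->
  tcomp (dprod f i) (iprod g i) = @tid K n /\
  tcomp (iprod g i) (dprod f i) = @tid K n.
Proof.
move=> tf tg fg gf; move: i; apply: ord_down_ind => [i i1|i i' i1 ii' [IH1 IH2]].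
  by rewrite iprod_last // dprod_last // tcomp1.
rewrite iprodS // dprodS // -ii'.
have [tD tI] := (TAut_dprod i' tf, TAut_iprod i' tg).
have f1 l (k : 'I_n) : f l k [::] = 1 by apply: TAut_nil.
have g1 l (k : 'I_n) : g l k [::] = 1 by apply: TAut_nil.
have D1 (k : 'I_n) : dprod f i' k [::] = 1 by apply: TAut_nil.
have I1 (k : 'I_n) : iprod g i' k [::] = 1 by apply: TAut_nil.
split.
  by rewrite -(tcompA _ D1 (f1 i)) (tcompA _ (f1 i) (g1 i)) fg tcomp1l.
by rewrite -(tcompA _ (g1 i) I1) (tcompA _ I1 D1) IH2 tcomp1l.
Qed.

End Products.

Section KV.
Variables (K : fieldType) (n : nat).
Hypothesis charK : [pchar K] =i pred0.
Local Notation A := (ncps K n).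
Variable u : 'I_2 -> ncps K 2.
Hypothesis tu : tDer u.
Let x1 := ncX K (ord0 : 'I_2).
Let x2 := ncX K (ord_max : 'I_2).

Let f (i : 'I_n) := texp (cable u i).
Let g (i : 'I_n) := texp (cable (fun b => - u b) i).

Lemma TAut_cable (i : 'I_n) : TAut (f i).
Proof. exact/(TAut_texp charK)/tDer_cable. Qed.

Lemma cabling1 (i : 'I_n) : subst (cabling K i) x1 = ncX K i.
Proof. by rewrite substX //; apply: cabling_nil. Qed.
Lemma cabling2 (i : 'I_n) : subst (cabling K i) x2 = tail K i.+1.
Proof. by rewrite substX //; apply: cabling_nil. Qed.
Lemma cabling12 (i : 'I_n) : subst (cabling K i) (x1 + x2) = tail K i.
Proof. by rewrite (clinearD (cabling_clinear _ _)) cabling1 cabling2 -tailS. Qed.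

Lemma act_dprod_lt (i l : 'I_n) : (l < i)%N ->
  act (dprod f i) (ncX K l) = ncX K l.
Proof.
move: i l; apply: ord_down_ind => [i i1 l _|i i' i1 ii' IH l li].
  by rewrite dprod_last // act_tid.
rewrite dprodS //; last exact: TAut_cable.
rewrite act_tcomp; first last.
- by move=> k; apply: TAut_nil; apply: TAut_cable.
- by move=> k; apply: TAut_nil; apply: (TAut_dprod charK); apply: TAut_cable.
by rewrite act_cable_lt // -ii' IH // ii' ltnS ltnW.
Qed.

Lemma nexp_act_dprod (i : 'I_n) :
  act (texp u) (x1 + x2) = nlog (nexp x1 * nexp x2) ->
  nexp (act (dprod f i) (tail K i)) =
  \prod_(l <- drop i (enum 'I_n)) nexp (ncX K l).
Proof.
move=> uP; move: i; apply: ord_down_ind => [i i1|i i' i1 ii' IH].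
  have ni : (n <= i.+1)%N by rewrite leqNgt.
  rewrite (dprod_last _ i1) act_tid tailS (tail_ge _ ni) addr0 drop_enum.
  by rewrite drop_oversize ?size_enum_ord // big_seq1.
have tf := TAut_cable.
rewrite (dprodS charK tf i1) act_tcomp; first last.
- by move=> k; apply: TAut_nil; apply: tf.
- by move=> k; apply: TAut_nil; apply: (TAut_dprod charK).
have [_ _ sM] := cabling_cmorph K i; have [_ _ aM] := act_cmorph (dprod f i').
have nx : (nexp x1 * nexp x2) [::] = 1 by rewrite nc_mul0E !nexp_nil mulr1.
have s0 (k : 'I_n) : ncX K k [::] = 0 by [].
rewrite -(cabling12 i) (act_cable charK i _ tu) uP -ii'.
have l0 : nlog (nexp x1 * nexp x2) [::] = 0 by apply: nlog_nil.
have sl0 : subst (cabling K i) (nlog (nexp x1 * nexp x2)) [::] = 0.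
  by rewrite (cmorph_nil _ (cabling_cmorph _ _)).
rewrite -(cmorph_nexp (act_cmorph _) sl0) -(cmorph_nexp (cabling_cmorph _ _) l0).
rewrite (nexp_nlog charK nx) sM.
rewrite (cmorph_nexp (cabling_cmorph _ _)) // (cmorph_nexp (cabling_cmorph _ _)) //.
rewrite cabling1 cabling2 aM drop_enum big_cons -ii' -IH.
rewrite (cmorph_nexp (act_cmorph _) (s0 _)) (cmorph_nexp (act_cmorph _) (tail_nil _ _ _)).
by rewrite act_dprod_lt ?ii'.
Qed.

Variables (j2 : ('I_2 -> ncps K 2) -> cyc K 2) (j : ('I_n -> A) -> cyc K n).
Hypotheses (jP2 : div_cocycle j2) (jP : div_cocycle j).
Variable h : nat -> K.
Hypothesis j2P :
  j2 (tinv (texp u)) = tocyc (ps h x1 + ps h x2 - ps h (x1 + x2)).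

Lemma TAut_cableN (i : 'I_n) : TAut (g i).
Proof. exact/(TAut_texp charK)/tDer_cable/tDerN. Qed.

Lemma j_cable (i : 'I_n) : j (g i) =
  tocyc (ps h (ncX K i) + ps h (tail K i.+1) - ps h (tail K i)).
Proof.
have tNu := tDerN tu; have cs := cabling_clinear K i.
rewrite (j_texp charK jP (tDer_cable i tNu)) jrep_cable //.
have <- : subst (cabling K i) (ps h x1 + ps h x2 - ps h (x1 + x2)) =
    ps h (ncX K i) + ps h (tail K i.+1) - ps h (tail K i).
  rewrite (clinearB cs) (clinearD cs) !(cmorph_ps _ (cabling_cmorph _ _)) //;
    last by rewrite nc_addE addr0.
  by rewrite cabling1 cabling2 cabling12.
apply: (tocyc_cmorph (cabling_cmorph K i)).
by rewrite -j2P tinv_texp // (j_texp charK jP2 tNu).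
Qed.

Lemma tocyc_act_cable (i : 'I_n) :
  let e := \sum_(l < n | (i < l)%N) ps h (ncX K l) - ps h (tail K i.+1) in
  tocyc (act (g i) e) = tocyc e.
Proof.
move=> e; have tNu := tDerN tu.
have [c c1 ac] := act_cable_gt i tNu.
have [ca _ _] := act_cmorph (g i); have [cc _ _] := conjnc_cmorph c1.
suff -> : act (g i) e = conjnc c e by exact: tocyc_conj.
rewrite /e (clinearB ca) (clinearB cc) (clinear_sum ca) (clinear_sum cc).
congr (_ - _).
  apply: eq_bigr => l il.
  by rewrite (cmorph_ps _ (act_cmorph _)) // (cmorph_ps _ (conjnc_cmorph c1)) // ac.
rewrite (cmorph_ps _ (act_cmorph _)) ?tail_nil //.
rewrite (cmorph_ps _ (conjnc_cmorph c1)) ?tail_nil //; congr (ps _ _).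
rewrite /tail (clinear_sum ca) (clinear_sum cc); apply: eq_bigr => l il.
exact: ac.
Qed.

Lemma j_iprod (i : 'I_n) : j (iprod g i) =
  tocyc (\sum_(l < n | (i <= l)%N) ps h (ncX K l) - ps h (tail K i)).
Proof.
have sumS (k : 'I_n) : \sum_(l < n | (k <= l)%N) ps h (ncX K l) =
    ps h (ncX K k) + \sum_(l < n | (k < l)%N) ps h (ncX K l).
  rewrite (bigD1 k) //=; congr (_ + _); apply: eq_bigl => l.
  by rewrite [RHS]ltn_neqAle andbC -val_eqE eq_sym.
move: i; apply: ord_down_ind => [i i1|i i' i1 ii' IH].
  have ni : (n <= i.+1)%N by rewrite leqNgt.
  rewrite (iprod_last _ i1) (j_tid jP) sumS tailS (tail_ge _ ni) addr0.
  rewrite big_pred0 ?addr0 ?subrr ?tocyc0 // => l; apply/negbTE.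
  by rewrite -leqNgt -ltnS; apply: leq_trans (ltn_ord l) ni.
have tg := TAut_cableN.
rewrite (iprodS _ i1) (jP.1 _ _ (tg i) (TAut_iprod charK _ tg)).
rewrite -ii' IH cyc_act_tocyc ii' tocyc_act_cable j_cable -tocycD; congr tocyc.
by rewrite sumS [_ + _ - ps h (tail K i)]addrAC addrACA subrr addr0 addrAC.
Qed.

Lemma tinv_dprod (i : 'I_n) : tinv (dprod f i) = iprod g i.
Proof.
have N1 (l : 'I_n) : (fun k => -1 *: cable u l k) = cable (fun b => - u b) l.
  by rewrite cableN; apply/funext => k; rewrite scaleN1r.
have fg (l : 'I_n) (s t : K) : s + t = 0 ->
    tcomp (texp (fun k => s *: cable u l k)) (texp (fun k => t *: cable u l k)) =
    @tid K n.
  move=> st; rewrite -texpD //; last exact: tDer_cable.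
  rewrite st -(texp0 K n); congr texp.
  by apply/funext => k; rewrite scale0r.
have fgl (l : 'I_n) : tcomp (f l) (g l) = @tid K n.
  by rewrite /f /g -N1 -(texp1 (cable u l)) fg ?subrr.
have gfl (l : 'I_n) : tcomp (g l) (f l) = @tid K n.
  by rewrite /f /g -N1 -(texp1 (cable u l)) fg ?addNr.
have [fgi gfi] := dprod_iprod charK i TAut_cable TAut_cableN fgl gfl.
apply: tinv_eq => //; [exact/TAut_dprod/TAut_cable|exact/TAut_iprod/TAut_cableN].
Qed.

End KV.

Theorem lemma7p3 (K : fieldType) (charK : [pchar K] =i pred0)
    (j : forall n : nat, ('I_n -> ncps K n) -> cyc K n)
    (jP : forall n : nat, div_cocycle (j n))
    (F : 'I_2 -> ncps K 2) (u : 'I_2 -> ncps K 2) :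
  TAut F -> tDer u -> F = texp u ->
  let x1 := ncX K (ord0 : 'I_2) in
  let x2 := ncX K (ord_max : 'I_2) in
  act F (x1 + x2) = nlog (nexp x1 * nexp x2) ->
  (exists h : nat -> K,
     j 2%N (tinv F) = tocyc (ps h x1 + ps h x2 - ps h (x1 + x2))) ->
  forall n : nat, (2 <= n)%N ->
  [/\ TAut (Fn n u),
      act (Fn n u) (\sum_(i < n) ncX K i) = nlog (\prod_(i < n) nexp (ncX K i)) &
      exists h : nat -> K,
        j n (tinv (Fn n u)) =
        tocyc (\sum_(i < n) ps h (ncX K i) - ps h (\sum_(i < n) ncX K i))].
Proof.
move=> _ tu -> x1 x2 uP [h jh] n n2; have n0 : (0 < n)%N by apply: ltnW.
pose i0 := Ordinal n0.
have FnE : Fn n u = dprod (fun i => texp (cable u i)) i0.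
  by rewrite /dprod drop0.
have tf := TAut_cable (n := n) charK tu.
have sE : \sum_(i < n) ncX K i = tail K i0 by [].
split.
- by rewrite FnE; apply: TAut_dprod.
- have := nexp_act_dprod charK tu i0 uP; rewrite drop0 enumT [index_enum _]unlock => <-.
  by rewrite FnE sE nlog_nexp // act_nil tail_nil.
exists h; rewrite FnE tinv_dprod // sE.
exact: (j_iprod charK tu (jP 2%N) (jP n) jh i0).
Qed.
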